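(* Let $\Omega\subset\mathbb{R}^2$ be an open, bounded, sufficiently regular domain with unit outward normal $\bm{n}$ on $\partial\Omega$. Let $\bm{\sigma}_1,\bm{\sigma}_2$ be planar residual stresses on $\Omega$, i.e. symmetric, square-integrable second-order tensor fields on $\Omega$ with $\operatorname{div}\bm{\sigma}_k=\bm{0}$ in $\Omega$ and $\bm{\sigma}_k\bm{n}=\bm{0}$ on $\partial\Omega$ ($k=1,2$). Then $$\int_\Omega \bm{\sigma}_1\cdot\bm{\sigma}_2\,dA=\int_\Omega \bar\sigma_1\,\bar\sigma_2\,dA,$$ where $\bar\sigma_k=\sigma_{k,xx}+\sigma_{k,yy}$ denotes the planar trace of $\bm{\sigma}_k$.
   Context: $\bm{A}\cdot\bm{B}=A_{ij}B_{ij}$ denotes full contraction of second-order tensors; $\operatorname{div}\bm{\sigma}=\sigma_{ij,j}\bm{e}_i$. *)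

(* Defs.v *)
From HB Require Import structures.
From mathcomp Require Import all_boot all_order all_algebra.
From mathcomp Require Import all_classical all_reals all_analysis.
Set Implicit Arguments. Unset Strict Implicit. Unset Printing Implicit Defensive.
Import Order.TTheory GRing.Theory Num.Theory.
Import numFieldNormedType.Exports.
Local Open Scope classical_set_scope.
Local Open Scope ring_scope.

Definition area (R : realType) := ((@lebesgue_measure R) \x (@lebesgue_measure R))%E.
Arguments area R : clear implicits.

Definition unit_dir (R : realType) (j : 'I_2) : R * R :=
  if j == 0 then (1, 0) else (0, 1).

Definition partial (R : realType) (j : 'I_2) (g : R * R -> R) (p : R * R) : R :=
  'D_(unit_dir R j) g p.

(* C^1 scalar function on the whole plane: differentiable everywhere with
   continuous partial derivatives (test functions, smooth up to the boundary
   after restriction to the closure of Omega). *)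
Definition C1_plane (R : realType) (g : R * R -> R) : Prop :=
  (forall p, differentiable g p) /\ (forall j : 'I_2, continuous (partial j g)).

Definition contr (R : realType) (A B : 'M[R]_2) : R :=
  \sum_(i < 2) \sum_(j < 2) A i j * B i j.

(* Planar residual stress on Omega:
   symmetric, square integrable, div sigma = 0 in Omega and sigma n = 0 on the
   boundary, the two equilibrium conditions being taken in the standard weak
   (principle of virtual work) sense:
     int_Omega sigma_ij  d v_i / d x_j  dA = 0  for every C^1 test field v. *)
Definition residual_stress (R : realType) (Omega : set (R * R))
    (sigma : R * R -> 'M[R]_2) : Prop :=
  [/\ (forall p, Omega p -> (sigma p)^T = sigma p),
      (forall i j : 'I_2,
         (area R).-integrable Omega (fun p => ((sigma p i j) ^+ 2)%:E)
         /\ measurable_fun Omega (fun p => sigma p i j)) &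
      (forall v : 'I_2 -> R * R -> R, (forall i, C1_plane (v i)) ->
         (\int[area R]_(p in Omega)
            (\sum_(i < 2) \sum_(j < 2) sigma p i j * partial j (v i) p)%:E)%E
         = 0%E)].

(* Main.v *)
Require Import Defs.
From HB Require Import structures.
From mathcomp Require Import all_boot all_order all_algebra.
From mathcomp Require Import finmap.
From mathcomp Require Import all_classical all_reals all_analysis.
From mathcomp Require Import measurable_realfun.
From mathcomp Require Import ring lra.
Import Order.TTheory GRing.Theory Num.Theory.
Import numFieldNormedType.Exports.
Local Open Scope classical_set_scope.
Local Open Scope ring_scope.

(** Extended by zero, a residual stress is a compactly supported L2 field on the
    whole plane whose rows are weakly divergence free. In the plane,
      tr s tr t - s . t = s11 t22 + s22 t11 - 2 s12 t12
    for symmetric s and t. Pair the two stresses through a smooth kernel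
    K(p - q) = f(x) g''(y). The virtual work principle in p or in q moves a
    derivative of the kernel from one component to another, and in this way each of
    the terms s11 t22, s22 t11 and s12 t12 becomes the pairing of s11 and t11
    through f''(x) g(y). The three contributions cancel, so the pairing vanishes for
    every such kernel. Letting K concentrate at the origin gives the theorem, since
    translations are continuous in L2. *)

(** Both stresses are merely square integrable, so neither can serve as a test field for the other,
    and no Airy potential is built. The kernel removes this obstacle: once one of the two points is
    frozen, it is a [C^1] function of the other point, to which virtual work applies. Test fields
    need not vanish on the boundary of Omega, so the traction-free condition is part of that
    principle and the extension by zero creates no boundary term. The two factors of the kernel play
    unequal roles. The kernel must be nonnegative and supported near the origin. Hence [f] is itself
    a bump, whereas in the other variable the bump is [g'']; a nonzero nonnegative [g''] forces [g]
    to have unbounded support. The pairings still make sense because the extended stresses have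
    bounded support, which is why bounds on kernels are required only where the paired functions are
    nonzero. *)

Local Notation plane R := (measurableTypeR R * measurableTypeR R)%type.

(** * Measure-preserving maps and translations of the plane *)

Definition measure_preserving {d} {T : measurableType d} {R : realType}
  (mu : {measure set T -> \bar R}) (f : T -> T) :=
  measurable_fun setT f /\
  forall A, measurable A -> mu (f @^-1` A) = mu A.

Section measure_preserving_integral.
Context {d} {T : measurableType d} {R : realType}.
Variables (mu : {measure set T -> \bar R}) (f : T -> T).
Hypothesis pf : measure_preserving mu f.
Implicit Type h : T -> \bar R.

Lemma ge0_integral_preserving h :
  measurable_fun setT h -> (forall x, (0 <= h x)%E) ->
  (\int[mu]_x h (f x) = \int[mu]_x h x)%E.
Proof.
case: pf => mf fmu mh h0.
transitivity (\int[pushforward mu f]_x h x)%E.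
  by rewrite ge0_integral_pushforward.
by apply: eq_measure_integral => // A mA _; rewrite /= /pushforward fmu.
Qed.

Lemma integral_preserving h : mu.-integrable setT h ->
  (\int[mu]_x h (f x) = \int[mu]_x h x)%E.
Proof.
move=> /measurable_int mh.
rewrite integralE [RHS]integralE.
rewrite -(ge0_integral_preserving (h^\+)%E)//; last exact: measurable_funepos.
rewrite -(ge0_integral_preserving (h^\-)%E)//; last exact: measurable_funeneg.
by congr (_ - _)%E; apply: eq_integral => x _; rewrite (funepos_comp, funeneg_comp).
Qed.

End measure_preserving_integral.

(** The pushforward of the product measure takes the right values on measurable rectangles, and a
    product measure is determined by those. *)
Lemma product_measure_preserving {d1 d2} {T1 : measurableType d1}
    {T2 : measurableType d2} {R : realType}
    (m1 : {sigma_finite_measure set T1 -> \bar R})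
    (m2 : {sigma_finite_measure set T2 -> \bar R}) (f1 : T1 -> T1) (f2 : T2 -> T2) :
  measure_preserving m1 f1 -> measure_preserving m2 f2 ->
  measure_preserving (m1 \x m2)%E (fun x => (f1 x.1, f2 x.2)).
Proof.
move=> [mf1 pf1] [mf2 pf2].
have mf : measurable_fun setT (fun x : T1 * T2 => (f1 x.1, f2 x.2)).
  by apply: measurable_fun_pair; exact: measurableT_comp.
split=> // A mA.
rewrite [RHS](@product_measure_unique _ _ _ _ _ m1 m2 (pushforward (m1 \x m2)%E
  (fun x : T1 * T2 => (f1 x.1, f2 x.2))))// => X Y mX mY.
rewrite /= /pushforward.
rewrite [X in (m1 \x m2)%E X](_ : _ = (f1 @^-1` X) `*` (f2 @^-1` Y))//.
rewrite product_measure1E.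
- by rewrite pf1// pf2.
- by rewrite -[X in measurable X]setTI; exact: mf1.
- by rewrite -[X in measurable X]setTI; exact: mf2.
Qed.

(** Lebesgue measure is determined by the lengths of half-open intervals, which shifts preserve. *)
Lemma lebesgue_measure_preserving_shift (R : realType) (t : R) :
  measure_preserving (@lebesgue_measure R) (fun x : measurableTypeR R => (x : R) + t).
Proof.
have ms : measurable_fun [set: measurableTypeR R]
    ((fun x => x + t) : measurableTypeR R -> measurableTypeR R).
  exact: measurable_funD.
split=> // A mA; apply/esym.
apply: (@lebesgue_measure_unique R (pushforward lebesgue_measure
  ((fun x => x + t) : measurableTypeR R -> measurableTypeR R)) _ A mA).
move=> X [[a b] _ <-] /=; rewrite /pushforward.
rewrite [X in _ = lebesgue_measure X](_ : _ = `](a - t), (b - t)]%classic).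
  rewrite !lebesgue_measure_itv/= !lte_fin ltrD2r -!EFinB.
  by rewrite (_ : b - t - (a - t) = b - a)//; ring.
by apply/seteqP; split=> x/=; rewrite !in_itv/=; lra.
Qed.

Definition translation {R : realType} (z x : measurableTypeR R * measurableTypeR R) :
    measurableTypeR R * measurableTypeR R :=
  ((x.1 : R) + z.1, (x.2 : R) + z.2).

Lemma area_preserving_translation (R : realType) z :
  measure_preserving (area R) (translation z).
Proof.
exact: (product_measure_preserving _ _ _ _
  (lebesgue_measure_preserving_shift _ z.1) (lebesgue_measure_preserving_shift _ z.2)).
Qed.

(** * Continuity in L2 along a family of measure-preserving maps *)

Section L2_continuity.
Context {d} {T : measurableType d} {R : realType}.
Variable mu : {measure set T -> \bar R}.

(** The square of the L2 norm, kept in the extended reals: it makes sense for every function and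
    avoids both square roots and quotient spaces. *)
Definition sqnorm (u : T -> R) : \bar R := (\int[mu]_x ((u x) ^+ 2)%:E)%E.

Implicit Types u v b c : T -> R.

Lemma sqnorm_ge0 u : (0 <= sqnorm u)%E.
Proof. by apply: integral_ge0 => x _; rewrite lee_fin sqr_ge0. Qed.

(** Stands in for the triangle inequality; the pointwise gap between the two sides is
    [(u x - v x) ^+ 2]. *)
Lemma sqnormD u v : measurable_fun setT u -> measurable_fun setT v ->
  (sqnorm (fun x => u x + v x)%R <= 2%:E * sqnorm u + 2%:E * sqnorm v)%E.
Proof.
move=> mu_ mv; rewrite /sqnorm.
have m2 (w : T -> R) : measurable_fun setT w -> measurable_fun setT (fun x => ((w x) ^+ 2)%:E).
  by move=> mw; apply/measurable_EFinP; exact: measurable_funX.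
have p2 (w : T -> R) x : setT x -> (0 <= ((w x) ^+ 2)%:E)%E.
  by move=> _; rewrite lee_fin sqr_ge0.
rewrite -!ge0_integralZl_EFin//; [|exact: p2|exact: m2|exact: p2|exact: m2].
have mZ (w : T -> R) : measurable_fun setT w ->
    measurable_fun setT (fun x => 2%:E * ((w x) ^+ 2)%:E)%E.
  by move=> mw; apply: measurable_funeM; exact: m2.
have pZ (w : T -> R) x : setT x -> (0 <= 2%:E * ((w x) ^+ 2)%:E)%E.
  by move=> _; rewrite -EFinM lee_fin mulr_ge0// sqr_ge0.
rewrite -ge0_integralD//; [|exact: pZ|exact: mZ|exact: pZ|exact: mZ].
apply: ge0_le_integral => //.
- by move=> x _; rewrite lee_fin sqr_ge0.
- by apply: m2; exact: measurable_funD.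
- by apply: emeasurable_funD; exact: mZ.
- by move=> x _; rewrite -!EFinM -EFinD lee_fin; have := sqr_ge0 (u x - v x); nra.
Qed.

Lemma sqnormZ k u : measurable_fun setT u ->
  sqnorm (fun x => k * u x) = ((k ^+ 2)%:E * sqnorm u)%E.
Proof.
move=> mu_; rewrite /sqnorm -ge0_integralZl_EFin//.
- by apply: eq_integral => x _; rewrite exprMn EFinM.
- by move=> x _; rewrite lee_fin sqr_ge0.
- by apply/measurable_EFinP; exact: measurable_funX.
- exact: sqr_ge0.
Qed.

Lemma sqnorm_indic A : measurable A -> sqnorm (\1_A) = mu A.
Proof.
move=> mA; rewrite /sqnorm -[in RHS](setIT A) -(integral_indic mu measurableT)//.
by apply: eq_integral => x _; rewrite indicE; case: (x \in A); rewrite ?expr1n// expr0n.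
Qed.

Context {Z : Type} (F : set_system Z) {FF : Filter F} (tau : Z -> T -> T).
Hypothesis ptau : forall z, measure_preserving mu (tau z).

Let mtau z : measurable_fun setT (tau z). Proof. by have [] := ptau z. Qed.

(** The parameter [z] runs along an arbitrary filter and [tau] is any measure-preserving family, so
    that the geometry of the plane enters only through indicators of rectangles. *)
Definition L2_continuous (b : T -> R) := measurable_fun setT b /\
  forall eps, 0 < eps ->
    \forall z \near F, (sqnorm (fun q => b (tau z q) - b q)%R <= eps%:E)%E.

Lemma L2_continuousZ k b : L2_continuous b -> L2_continuous (fun q => k * b q).
Proof.
move=> [mb cb]; split; first exact: measurable_funM.
(* Dividing by [k ^+ 2 + 1] instead of [k ^+ 2] covers [k = 0] without a case split. *)
move=> eps eps0; have k0 : 0 < k ^+ 2 + 1 by rewrite ltr_wpDl// sqr_ge0.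
apply: filterS (cb (eps / (k ^+ 2 + 1)) _); last by rewrite divr_gt0.
move=> z zb.
rewrite (_ : (fun q => _) = (fun q => k * (b (tau z q) - b q))); last first.
  by apply/funext => q; rewrite mulrBr.
rewrite sqnormZ; last first.
  by apply: measurable_funB => //; exact: measurableT_comp.
apply: (@le_trans _ _ ((k ^+ 2)%:E * (eps / (k ^+ 2 + 1))%:E)%E).
  by rewrite lee_wpmul2l// lee_fin sqr_ge0.
rewrite -EFinM lee_fin mulrA ler_pdivrMr// mulrC ler_pM2l//; lra.
Qed.

Lemma L2_continuousD b c : L2_continuous b -> L2_continuous c ->
  L2_continuous (fun q => b q + c q).
Proof.
move=> [mb cb] [mc cc]; split; first exact: measurable_funD.
move=> eps eps0; have e4 : 0 < eps / 4 by rewrite divr_gt0.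
apply: filterS2 (cb _ e4) (cc _ e4) => z zb zc.
rewrite (_ : (fun q => _) =
    (fun q => (b (tau z q) - b q) + (c (tau z q) - c q))); last first.
  by apply/funext => q; ring.
apply: (le_trans (sqnormD _ _ _ _)).
- by apply: measurable_funB => //; exact: measurableT_comp.
- by apply: measurable_funB => //; exact: measurableT_comp.
apply: (@le_trans _ _ (2%:E * (eps / 4)%:E + 2%:E * (eps / 4)%:E)%E).
  by apply: leeD; rewrite lee_wpmul2l// lee_fin.
by rewrite -!EFinM -EFinD lee_fin; lra.
Qed.

Lemma L2_continuousB b c : L2_continuous b -> L2_continuous c ->
  L2_continuous (fun q => b q - c q).
Proof.
move=> cb cc; have := L2_continuousD _ _ cb (L2_continuousZ (-1) _ cc).
by congr L2_continuous; apply/funext => q; rewrite mulN1r.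
Qed.

Lemma L2_continuous0 : L2_continuous (fun=> 0).
Proof.
split => // eps eps0; apply: nearW => z.
rewrite /sqnorm; under eq_integral do rewrite subrr expr0n/=.
by rewrite integral0 lee_fin ltW.
Qed.

Lemma L2_continuous_sum {J : Type} (s : seq J) (h : J -> T -> R) :
  (forall j, L2_continuous (h j)) -> L2_continuous (fun q => \sum_(j <- s) h j q).
Proof.
move=> ch; elim: s => [|j s IH].
  by under eq_fun do rewrite big_nil; exact: L2_continuous0.
by under eq_fun do rewrite big_cons; exact: L2_continuousD.
Qed.

(** Young's inequality with weight [eta], [|u b| <= u^2 / (2 eta) + eta b^2 / 2], does the work of
    Cauchy-Schwarz. *)
Lemma L2_continuous_pairing a b : L2_continuous a ->
  measurable_fun setT b -> (sqnorm b < +oo)%E -> forall eps, 0 < eps ->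
  \forall z \near F,
    (\int[mu]_q (`|(a (tau z q) - a q) * b q|)%:E <= eps%:E)%E.
Proof.
move=> [ma ca] mb boo eps eps0.
have bfin : sqnorm b \is a fin_num by rewrite ge0_fin_numE// sqnorm_ge0.
set B := fine (sqnorm b).
have B0 : 0 <= B by rewrite fine_ge0// sqnorm_ge0.
have B1 : 0 < B + 1 by lra.
(* With this weight the [b] term is at most [eps / 2], and asking for [sqnorm mu u <= eta * eps]
   makes the other term at most [eps / 2]. The [+ 1] guards against [B = 0]. *)
pose eta := eps / (B + 1).
have eta0 : 0 < eta by rewrite divr_gt0.
have etaB : eta * (B + 1) = eps by rewrite /eta divfK// gt_eqF.
have ee : 0 < eta * eps by rewrite mulr_gt0.
apply: filterS (ca _ ee) => z za.
pose u q := a (tau z q) - a q.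
have mu_ : measurable_fun setT u.
  by apply: measurable_funB => //; exact: measurableT_comp.
have m2 (w : T -> R) k : measurable_fun setT w ->
    measurable_fun setT (fun x => k%:E * ((w x) ^+ 2)%:E)%E.
  by move=> mw; apply/measurable_funeM/measurable_EFinP; exact: measurable_funX.
have p2 (w : T -> R) k x : 0 <= k -> (0 <= k%:E * ((w x) ^+ 2)%:E)%E.
  by move=> k0; rewrite -EFinM lee_fin mulr_ge0// sqr_ge0.
have k1 : 0 <= (2 * eta)^-1 by rewrite invr_ge0; lra.
have k2 : 0 <= eta / 2 by lra.
apply: (@le_trans _ _ (\int[mu]_q (((2 * eta)^-1)%:E * ((u q) ^+ 2)%:E +
    (eta / 2)%:E * ((b q) ^+ 2)%:E))%E).
  apply: ge0_le_integral => //.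
  - by apply/measurable_EFinP/measurableT_comp => //; exact: measurable_funM.
  - by apply: emeasurable_funD; exact: m2.
  move=> q _; rewrite -!EFinM -EFinD lee_fin -/(u q).
  have -> : (2 * eta)^-1 * u q ^+ 2 + eta / 2 * b q ^+ 2 =
      (2 * eta)^-1 * (u q ^+ 2 + (eta * b q) ^+ 2).
    by field; rewrite gt_eqF.
  rewrite -(ler_pM2l (_ : 0 < 2 * eta)); last lra.
  rewrite mulVKf; last by rewrite gt_eqF//; lra.
  rewrite normrM -[u q ^+ 2]real_normK ?num_real//.
  rewrite -[(eta * _) ^+ 2]real_normK ?num_real// normrM (gtr0_norm eta0).
  have := sqr_ge0 (`|u q| - eta * `|b q|); lra.
rewrite ge0_integralD//; [|by move=> *; exact: p2|exact: m2|by move=> *; exact: p2|exact: m2].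
rewrite !ge0_integralZl_EFin//;
  [|by move=> *; rewrite lee_fin sqr_ge0|by apply/measurable_EFinP/measurable_funX
   |by move=> *; rewrite lee_fin sqr_ge0|by apply/measurable_EFinP/measurable_funX].
rewrite -/(sqnorm b) -/(sqnorm u) -(fineK bfin) -/B.
apply: (@le_trans _ _ (((2 * eta)^-1)%:E * (eta * eps)%:E + (eta / 2)%:E * B%:E)%E).
  by rewrite leeD2r// lee_wpmul2l// lee_fin.
rewrite -!EFinM -EFinD lee_fin.
rewrite (_ : (2 * eta)^-1 * (eta * eps) = eps / 2); last by field; rewrite gt_eqF.
by nra.
Qed.

(** The usual three-term splitting through [c]: since [tau z] preserves the measure, the translated
    error [b - c] is as small as the error itself. *)
Lemma L2_continuous_lim b : measurable_fun setT b ->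
  (forall eps, 0 < eps ->
    exists2 c, L2_continuous c & (sqnorm (fun q => b q - c q)%R <= eps%:E)%E) ->
  L2_continuous b.
Proof.
(* Two nested uses of [sqnormD] give the total weight [2 + 2 * (2 + 2) = 10]. *)
move=> mb bc; split => // eps eps0; have e10 : 0 < eps / 10 by rewrite divr_gt0.
have [c [mc cc] bce] := bc _ e10.
apply: filterS (cc _ e10) => z zc.
rewrite (_ : (fun q => _) = (fun q => (b (tau z q) - c (tau z q)) +
    ((c (tau z q) - c q) + (-1) * (b q - c q)))); last first.
  by apply/funext => q; ring.
have mbc : measurable_fun setT (fun q => b q - c q) by exact: measurable_funB.
have mbc' : measurable_fun setT (fun q => -1 * (b q - c q)) by exact: measurable_funM.
have mct : measurable_fun setT (fun q => c (tau z q) - c q).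
  by apply: measurable_funB => //; exact: measurableT_comp.
apply: (le_trans (sqnormD _ _ _ _)).
- by apply: measurable_funB; exact: measurableT_comp.
- exact: measurable_funD.
have e1 : (sqnorm (fun q => b (tau z q) - c (tau z q))%R <= (eps / 10)%:E)%E.
  apply: le_trans bce; rewrite /sqnorm.
  rewrite (ge0_integral_preserving mu _ (ptau z) (fun q => ((b q - c q) ^+ 2)%:E))//.
  - by apply/measurable_EFinP; exact: measurable_funX.
  - by move=> x; rewrite lee_fin sqr_ge0.
have e2 : (sqnorm (fun q => (c (tau z q) - c q) + (-1) * (b q - c q))%R <=
    (4 * (eps / 10))%:E)%E.
  apply: (le_trans (sqnormD _ _ mct mbc')).
  rewrite sqnormZ// (_ : (-1) ^+ 2 = 1) ?mul1e; last by rewrite sqrrN expr1n.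
  apply: (@le_trans _ _ (2%:E * (eps / 10)%:E + 2%:E * (eps / 10)%:E)%E).
    by apply: leeD; rewrite lee_wpmul2l// lee_fin.
  by rewrite -!EFinM -EFinD lee_fin; lra.
apply: (@le_trans _ _ (2%:E * (eps / 10)%:E + 2%:E * (4 * (eps / 10))%:E)%E).
  by apply: leeD; rewrite lee_wpmul2l// lee_fin.
by rewrite -!EFinM -EFinD lee_fin; lra.
Qed.

Variables (Q : set T) (G : set (set T)).
Hypotheses (mQ : measurable Q) (Qoo : (mu Q < +oo)%E).
Hypotheses (GE : @measurable _ T = <<s G >>) (GI : setI_closed G).
Hypotheses (cQ : L2_continuous (\1_Q))
  (cG : forall A, G A -> L2_continuous (\1_(A `&` Q))).

(** Dynkin induction from the generating pi-system [G]. Cutting by [Q] turns complements into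
    differences with [\1_Q] and keeps all measures finite, which makes the tails of a disjoint union
    tend to zero. *)
Lemma L2_continuous_indic A : measurable A -> L2_continuous (\1_(A `&` Q)).
Proof.
move=> mA; have : <<s G >> A by rewrite -GE.
apply: (@dynkin_induction _ T G (fun A => L2_continuous (\1_(A `&` Q)))) => //.
- by rewrite setTI.
- move=> S mS cS; have := L2_continuousB _ _ cQ cS.
  congr L2_continuous; apply/funext => q; rewrite !indicE !in_setI in_setC.
  by case: (q \in S); case: (q \in Q); rewrite ?subrr ?subr0.
move=> H mH tH cH.
pose U n := \big[setU/set0]_(i < n) H i.
have mU n : measurable (U n) by exact: bigsetU_measurable.
have cU n : L2_continuous (\1_(U n `&` Q)).
  elim: n => [|n IH].
    rewrite /U big_ord0 set0I; have := L2_continuous0.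
    by congr L2_continuous; apply/funext => q; rewrite indicE in_set0.
  have := L2_continuousD _ _ IH (cH n).
  congr L2_continuous; apply/funext => q; rewrite !indicE !in_setI /U big_ord_recr/=.
  rewrite in_setU; have [qH|] := boolP (q \in H n); last by rewrite orbF /= addr0.
  have -> : (q \in \big[setU/set0]_(i < n) H i) = false.
    apply/negbTE/negP; rewrite inE -bigcup_mkord => -[i /= ltin Hiq].
    have /trivIsetP /(_ i n I I) := tH; rewrite (ltn_eqF ltin) => /(_ erefl).
    by rewrite -subset0 => /(_ q); apply; split => //; rewrite inE in qH.
  by rewrite orbT /= add0r.
apply: L2_continuous_lim.
  by apply: measurable_indic; apply: measurableI => //; exact: bigcup_measurable.
move=> eps eps0.
(* The part of the union missed by the first [n] sets: its measure is exactly the squared L2 error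
   of the [n]-th partial union. *)
pose D n := (\bigcup_k H k `&` Q) `\` U n.
have mHQ : measurable (\bigcup_k H k `&` Q).
  by apply: measurableI => //; exact: bigcup_measurable.
have mD n : measurable (D n) by exact: measurableD.
have : mu \o D @ \oo --> mu (\bigcap_n D n).
  apply: nonincreasing_cvg_mu => //.
  - apply: le_lt_trans Qoo; apply: le_measure; rewrite ?inE//.
    by move=> x [[]].
  - exact: bigcapT_measurable.
  - move=> m n mn; apply/subsetPset => x [xHQ xU]; split => //; apply: contra_not xU.
    rewrite /U -!bigcup_mkord. move=> -[i /= im Hix].
    by exists i => //=; exact: leq_trans mn.
have -> : \bigcap_n D n = set0.
  rewrite -subset0 => x /= xD; have [[k _ Hkx] _] := (xD 0%N I).1.
  have [_] := xD k.+1 I; apply; rewrite /U -bigcup_mkord; exists k => //=.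
rewrite measure0 => /fine_cvgP[Dfin /cvgr0Pnorm_lt /(_ _ eps0) Dlt].
near \oo => n; exists (\1_(U n `&` Q)) => //.
rewrite (_ : (fun q => _) = \1_(D n)); last first.
  apply/funext => q; rewrite !indicE /D in_setD !in_setI.
  have [qU|qU] := boolP (q \in U n); last by rewrite subr0 andbT.
  rewrite (_ : q \in \bigcup_k H k) ?subrr ?andbF// inE.
  by move: qU; rewrite inE /U -bigcup_mkord => -[i _ ?]; exists i.
rewrite sqnorm_indic//.
have Dn : mu (D n) \is a fin_num by near: n.
rewrite -(fineK Dn) lee_fin ltW//.
have : `|fine (mu (D n))| < eps by near: n.
by rewrite ger0_norm// fine_ge0.
Unshelve. all: by end_near. Qed.

Import HBNNSimple.

(** Increasing simple functions converge to [b] in L2 by dominated convergence, with [b ^+ 2] as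
    dominating function. *)
Lemma L2_continuous_ge0 b : measurable_fun setT b -> (forall x, 0 <= b x) ->
  (forall x, ~ Q x -> b x = 0) -> (sqnorm b < +oo)%E -> L2_continuous b.
Proof.
move=> mb b0 bQ boo.
have mEb : measurable_fun setT (EFin \o b) by exact/measurable_EFinP.
have Eb0 x : setT x -> (0 <= (EFin \o b) x)%E by move=> _; rewrite lee_fin.
pose f := nnsfun_approx measurableT mEb.
(* The factor [\1_Q] gives the level sets the form [A] cut by [Q] handled above; nothing is lost
   because [b] vanishes off [Q]. *)
pose c n x := f n x * \1_Q x.
have fb n x : f n x <= b x by rewrite -lee_fin /f nnsfun_approxE; exact: le_approx.
have f0 n x : 0 <= f n x by exact: fun_ge0.
have cb n x : 0 <= b x - c n x <= b x.
  rewrite /c indicE; have := fb n x; have := f0 n x; have := b0 x.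
  have [xQ|/negP xQ] := boolP (x \in Q).
    by rewrite mulr1 => *; apply/andP; split; lra.
  rewrite mulr0 bQ; last by move=> Qx; apply: xQ; rewrite inE.
  by rewrite subrr lexx.
have mc n : measurable_fun setT (c n).
  by apply: measurable_funM => //; exact: measurable_indic.
have cc n : L2_continuous (c n).
  have -> : c n = (fun q => \sum_(y <- fset_set (range (f n)))
      y * \1_((f n @^-1` [set y]) `&` Q) q).
    apply/funext => q; rewrite /c fimfunE fsbig_finite//= mulr_suml.
    by apply: eq_bigr => y _; rewrite -mulrA indicI.
  apply: L2_continuous_sum => i; apply: L2_continuousZ.
  exact: L2_continuous_indic.
apply: L2_continuous_lim => // eps eps0.
have : (fun n => \int[mu]_x ((b x - c n x) ^+ 2)%:E)%E @ \oo --> (\int[mu]_x (cst 0 x))%E.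
  have [] // := @dominated_convergence _ _ _ mu setT measurableT
    (fun n x => ((b x - c n x) ^+ 2)%:E) (cst 0%E) (fun x => ((b x) ^+ 2)%:E).
  - by move=> n; apply/measurable_EFinP/measurable_funX; exact: measurable_funB.
  - apply/aeW => x _; apply: cvg_EFin; first by exact: nearW.
    have fbx : f n x @[n --> \oo] --> b x.
      by have /fine_cvgP[] := cvg_nnsfun_approx measurableT mEb Eb0 (x := x) I.
    have cbx : c n x @[n --> \oo] --> b x.
      rewrite /c; have [xQ|xQ] := pselect (Q x).
        by rewrite indicE mem_set//; under eq_fun do rewrite mulr1.
      rewrite bQ// indicE memNset//; under eq_fun do rewrite mulr0.
      exact: cvg_cst.
    rewrite (_ : 0 = (b x - b x) ^+ 2); last by rewrite subrr expr0n.
    have cB := cvgB (cvg_cst (b x)) cbx.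
    under eq_fun do rewrite expr2.
    rewrite expr2; apply: cvgM; exact: cB.
  - apply/integrableP; split; first by apply/measurable_EFinP; exact: measurable_funX.
    by under eq_integral do rewrite gee0_abs ?lee_fin ?sqr_ge0//.
  - apply/aeW => x n _; rewrite gee0_abs ?lee_fin ?sqr_ge0//.
    by have /andP[? ?] := cb n x; rewrite ler_pXn2r// nnegrE.
rewrite integral0 => /fine_cvgP[Dfin /cvgr0Pnorm_lt /(_ _ eps0) Dlt].
near \oo => n; exists (c n) => //.
have Dn : sqnorm (fun q => b q - c n q) \is a fin_num by near: n.
rewrite -(fineK Dn) lee_fin ltW//.
have : `|fine (sqnorm (fun q => b q - c n q))| < eps by near: n.
by rewrite ger0_norm// fine_ge0// sqnorm_ge0.
Unshelve. all: by end_near. Qed.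

Lemma L2_continuous_integrable b : measurable_fun setT b ->
  (forall x, ~ Q x -> b x = 0) -> (sqnorm b < +oo)%E -> L2_continuous b.
Proof.
move=> mb bQ boo.
have -> : b = (fun q => Num.max (b q) 0 - Num.max (- b q) 0).
  by apply/funext => q; rewrite /Num.max; do 2 case: ifPn; lra.
have le_sq (u : T -> R) : measurable_fun setT u -> (forall x, (u x) ^+ 2 <= (b x) ^+ 2) ->
    (sqnorm u < +oo)%E.
  move=> mu_ ub; apply: le_lt_trans boo; apply: ge0_le_integral => //.
  - by move=> x _; rewrite lee_fin sqr_ge0.
  - by apply/measurable_EFinP; exact: measurable_funX.
  - by apply/measurable_EFinP; exact: measurable_funX.
  - by move=> x _; rewrite lee_fin.
have m1 : measurable_fun setT (fun q => Num.max (b q) 0) by exact: measurable_maxr.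
have m2 : measurable_fun setT (fun q => Num.max (- b q) 0).
  by apply: measurable_maxr => //; exact: measurableT_comp.
apply: L2_continuousB; apply: L2_continuous_ge0 => //.
- by move=> x; rewrite le_max lexx orbT.
- by move=> x xQ; rewrite bQ// maxxx.
- by apply: le_sq => // x; rewrite /Num.max; case: ifPn => ?; nra.
- by move=> x; rewrite le_max lexx orbT.
- by move=> x xQ; rewrite bQ// oppr0 maxxx.
- by apply: le_sq => // x; rewrite /Num.max; case: ifPn => ?; nra.
Qed.

End L2_continuity.

(** * Translations are continuous in L2 of the plane *)

Section plane_continuity.
Context (R : realType).

(** Half-open sides match the intervals generating the Borel sets of the line. Reversed endpoints
    give the empty set, so the family is closed under intersection without exceptions. *)
Definition rectangle (a b c d : R) : set (plane R) :=
  (`]a, b] : set (measurableTypeR R)) `*` (`]c, d] : set (measurableTypeR R)).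

Lemma measurable_rectangle a b c d : measurable (rectangle a b c d).
Proof. by apply: measurableX; exact: measurable_itv. Qed.

Lemma area_rectangle a b c d : a <= b -> c <= d ->
  area R (rectangle a b c d) = ((b - a) * (d - c))%:E.
Proof.
move=> ab cd; rewrite /area/= product_measure1E//=.
rewrite !lebesgue_measure_itv/= !lte_fin.
move: ab cd; rewrite !le_eqVlt => /predU1P[->|ab]; first by rewrite ltxx subrr mul0e mul0r.
move=> /predU1P[->|cd]; first by rewrite ltxx subrr mule0 mulr0.
by rewrite ab cd -!EFinB -EFinM.
Qed.

(** A product [A * B] is the intersection of a vertical and a horizontal strip, and a strip over a
    half-open interval is a countable union of rectangles of growing length. *)
Lemma rectangle_generates : @measurable _ (plane R) =
  <<s [set A | exists a b c d, A = rectangle a b c d] >>.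
Proof.
set G := [set A | _].
apply/seteqP; split; last first.
  apply: smallest_sub; first exact: sigma_algebra_measurable.
  by move=> _ [a [b [c [d ->]]]]; exact: measurable_rectangle.
have cover : [set: R] = \bigcup_n `]- n%:R, n%:R]%classic.
  apply/seteqP; split => // x _; exists (Num.bound `|x|) => //=.
  have := archi_boundP (normr_ge0 x); rewrite in_itv/= ltr_norml => /andP[->].
  exact: ltW.
pose sG := @measurable _ (g_sigma_algebraType G).
have strip1 (A : set (measurableTypeR R)) : measurable A -> sG (A `*` setT).
  move: A; apply: smallest_sub.
    split; first by rewrite set0X; exact: measurable0.
      move=> A mA; rewrite setTD (_ : ~` A `*` setT = ~` (A `*` setT)).
        exact: measurableC.
      by apply/seteqP; split => -[x y] /=; tauto.
    move=> H mH; rewrite (_ : _ `*` _ = \bigcup_k (H k `*` setT)).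
      exact: bigcupT_measurable.
    apply/seteqP; split => -[x y] /=; first by move=> [[k _ Hkx] _]; exists k.
    by move=> [k _ [Hkx _]]; split => //; exists k.
  move=> _ [[a b] _ <-] /=.
  rewrite (_ : _ `*` _ = \bigcup_n rectangle a b (- n%:R) n%:R).
    apply: bigcupT_measurable => n; apply: sub_sigma_algebra.
    by exists a, b, (- n%:R), n%:R.
  apply/seteqP; split => -[x y] /=; last by move=> [n _ []].
  move=> [xab _]; have : [set: R] y by []; rewrite cover => -[n _ yn].
  by exists n.
have strip2 (A : set (measurableTypeR R)) : measurable A -> sG (setT `*` A).
  move: A; apply: smallest_sub.
    split; first by rewrite setX0; exact: measurable0.
      move=> A mA; rewrite setTD (_ : setT `*` ~` A = ~` (setT `*` A)).
        exact: measurableC.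
      by apply/seteqP; split => -[x y] /=; tauto.
    move=> H mH; rewrite (_ : _ `*` _ = \bigcup_k (setT `*` H k)).
      exact: bigcupT_measurable.
    apply/seteqP; split => -[x y] /=; first by move=> [_ [k _ Hkx]]; exists k.
    by move=> [k _ [_ Hkx]]; split => //; exists k.
  move=> _ [[a b] _ <-] /=.
  rewrite (_ : _ `*` _ = \bigcup_n rectangle (- n%:R) n%:R a b).
    apply: bigcupT_measurable => n; apply: sub_sigma_algebra.
    by exists (- n%:R), n%:R, a, b.
  apply/seteqP; split => -[x y] /=; last by move=> [n _ []].
  move=> [_ yab]; have : [set: R] x by []; rewrite cover => -[n _ xn].
  by exists n.
rewrite measurable_prod_measurableType; apply: smallest_sub.
  exact: smallest_sigma_algebra.
move=> _ [A mA [B mB <-]].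
have -> : A `*` B = (A `*` setT) `&` (setT `*` B) by rewrite -setXI setIT setTI.
by apply: (@measurableI _ (g_sigma_algebraType G)); [exact: strip1|exact: strip2].
Qed.

Lemma rectangleI a b c d a' b' c' d' :
  rectangle a b c d `&` rectangle a' b' c' d' =
  rectangle (Num.max a a') (Num.min b b') (Num.max c c') (Num.min d d').
Proof.
rewrite /rectangle -setXI; congr (_ `*` _); apply/seteqP; split => x /=;
  rewrite !in_itv/= gt_max le_min.
- by move=> [/andP[-> ->] /andP[-> ->]].
- by move=> /andP[/andP[-> ->] /andP[-> ->]].
- by move=> [/andP[-> ->] /andP[-> ->]].
- by move=> /andP[/andP[-> ->] /andP[-> ->]].
Qed.

Local Notation L2_translation_continuous :=
  (L2_continuous (area R) (nbhs (0 : R * R)) (@translation R)).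

(** A translation by less than [D] in each coordinate changes the indicator only on the frame
    between the rectangle enlarged by [D] and the one shrunk by [D], of area
    [4 * D * (b - a + d - c)]. *)
Lemma L2_continuous_rectangle a b c d :
  L2_translation_continuous (\1_(rectangle a b c d)).
Proof.
have [ab|ba] := ltP a b; last first.
  rewrite (_ : rectangle a b c d = set0).
    by rewrite indic0; exact: L2_continuous0.
  by rewrite -subset0 => q [] /=; rewrite in_itv/= => /andP[]; lra.
have [cd|dc] := ltP c d; last first.
  rewrite (_ : rectangle a b c d = set0).
    by rewrite indic0; exact: L2_continuous0.
  by rewrite -subset0 => q [] _ /=; rewrite in_itv/= => /andP[]; lra.
split.
  by apply: measurable_indic; exact: measurable_rectangle.
move=> eps eps0.
(* The first two bounds keep the sides of the shrunk rectangle nonnegative; the third makes the area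
   of the frame at most [eps]. *)
pose D := Num.min (Num.min ((b - a) / 2) ((d - c) / 2))
  (eps / (4 * (b - a + d - c))).
have S0 : 0 < 4 * (b - a + d - c) by lra.
have D0 : 0 < D by rewrite !lt_min !divr_gt0//; lra.
have Da : D <= (b - a) / 2 by rewrite /D !ge_min lexx.
have Dc : D <= (d - c) / 2 by rewrite /D !ge_min lexx orbT.
have De : 4 * D * (b - a + d - c) <= eps.
  have : D <= eps / (4 * (b - a + d - c)) by rewrite /D ge_min lexx orbT.
  by rewrite ler_pdivlMr//; lra.
apply: filterS (nbhsx_ballx (0 : R * R) D D0) => z [/= z1 z2].
have {}z1 : `|z.1| < D by move: z1; rewrite /ball/= sub0r normrN.
have {}z2 : `|z.2| < D by move: z2; rewrite /ball/= sub0r normrN.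
pose Ao := rectangle (a - D) (b + D) (c - D) (d + D).
pose Ai := rectangle (a + D) (b - D) (c + D) (d - D).
have mAo : measurable Ao by exact: measurable_rectangle.
have mAi : measurable Ai by exact: measurable_rectangle.
have mA : measurable_fun setT (\1_(rectangle a b c d) : plane R -> R).
  by apply: measurable_indic; exact: measurable_rectangle.
have mt : measurable_fun setT (translation z).
  by have [] := area_preserving_translation R z.
apply: (@le_trans _ _ (\int[area R]_q (\1_(Ao `\` Ai) q)%:E)%E).
  apply: ge0_le_integral => //.
  - by move=> q _; rewrite lee_fin sqr_ge0.
  - apply/measurable_EFinP/measurable_funX/measurable_funB => //.
    exact: measurableT_comp.
  - by apply/measurable_EFinP/measurable_indic; exact: measurableD.
  move=> q _; rewrite lee_fin.
  have inner : Ai q -> rectangle a b c d (translation z q) /\ rectangle a b c d q.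
    move: z1 z2; rewrite !ltr_norml => /andP[? ?] /andP[? ?] [].
    rewrite /rectangle /translation /= !in_itv/= => /andP[? ?] /andP[? ?].
    by do ![split]; apply/andP; split; lra.
  have outer p : p = q \/ p = translation z q -> rectangle a b c d p -> Ao q.
    move: z1 z2; rewrite !ltr_norml => /andP[? ?] /andP[? ?] pq [] + +.
    rewrite /Ao /rectangle /= !in_itv/=.
    by case: pq => -> /= => /andP[? ?] /andP[? ?]; split; apply/andP; split; lra.
  rewrite !indicE in_setD.
  have [Aiq|Aiq] := pselect (Ai q).
    have [Az Aq] := inner Aiq.
    by rewrite (mem_set Az) (mem_set Aq) (mem_set Aiq) subrr expr0n andbF.
  rewrite (memNset Aiq) andbT.
  have [Aoq|Aoq] := pselect (Ao q).
    by rewrite (mem_set Aoq); do 2 case: (_ \in _); rewrite /=; lra.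
  have nA p : p = q \/ p = translation z q -> (p \in rectangle a b c d) = false.
    by move=> pq; rewrite memNset//; apply: contra_not Aoq; exact: outer.
  by rewrite !nA; [rewrite subrr expr0n|left|right].
rewrite integral_indic//; last exact: measurableD.
have areaAo : area R Ao = ((b + D - (a - D)) * (d + D - (c - D)))%:E.
  by apply: area_rectangle; lra.
have areaAi : area R Ai = ((b - D - (a + D)) * (d - D - (c + D)))%:E.
  by apply: area_rectangle; lra.
rewrite setIT measureD//; last first.
  by rewrite [X in (X < _)%E]areaAo ltry.
rewrite (_ : Ao `&` Ai = Ai); last first.
  apply/setIidr => q [] /=; rewrite !in_itv/= => /andP[? ?] /andP[? ?].
  by split; rewrite /= in_itv/=; apply/andP; split; lra.
rewrite [X in (X - _)%E]areaAo [X in (_ - X)%E]areaAi.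
by rewrite -EFinB lee_fin; apply: le_trans De; nra.
Qed.

Lemma L2_translation_continuous_bounded (M : R) (b : plane R -> R) :
  measurable_fun setT b -> (forall q, b q != 0 -> `|q.1| < M /\ `|q.2| < M) ->
  (sqnorm (area R) b < +oo)%E -> L2_translation_continuous b.
Proof.
move=> mb bM boo.
(* No sign is assumed on [M]; a point where [b] is nonzero forces [0 < M]. *)
have [b0|] := pselect (forall q, b q = 0).
  rewrite (_ : b = fun=> 0); first exact: L2_continuous0.
  by apply/funext.
move=> /existsNP[q0 /eqP /bM [M0 _]].
have {}M0 : 0 < M by apply: le_lt_trans M0.
pose Q := rectangle (- M) M (- M) M.
apply: (@L2_continuous_integrable _ _ _ (area R) _ (nbhs (0 : R * R)) _
  (@translation R) (area_preserving_translation R) Q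
  [set A | exists a b c d, A = rectangle a b c d]) => //.
- exact: measurable_rectangle.
- have areaQ : area R Q = ((M - - M) * (M - - M))%:E by apply: area_rectangle; lra.
  by rewrite [X in (X < _)%E]areaQ ltry.
- exact: rectangle_generates.
- move=> _ _ [a1 [b1 [c1 [d1 ->]]]] [a2 [b2 [c2 [d2 ->]]]]; rewrite rectangleI.
  by do 4 eexists.
- exact: L2_continuous_rectangle.
- move=> _ [a1 [b1 [c1 [d1 ->]]]]; rewrite rectangleI.
  exact: L2_continuous_rectangle.
- move=> q Qq; apply/eqP; apply: contra_notT Qq => /bM.
  rewrite !ltr_norml => -[/andP[? ?] /andP[? ?]].
  by rewrite /Q /rectangle; split; rewrite /= in_itv/=; apply/andP; split; lra.
Qed.

End plane_continuity.

(** * Area as a sigma-finite measure *)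

Lemma area_sigma_finite (R : realType) : sigma_finite setT (area R).
Proof.
exists (fun n => rectangle R (- n%:R) n%:R (- n%:R) n%:R).
  apply/seteqP; split => // -[x y] _.
  have [n nx ny] : exists2 n : nat, `|x : R| < n%:R & `|y : R| < n%:R.
    have x0 := archi_boundP (normr_ge0 (x : R)); have y0 := archi_boundP (normr_ge0 (y : R)).
    exists (maxn (Num.bound `|x : R|) (Num.bound `|y : R|)).
      by apply: lt_le_trans x0 _; rewrite ler_nat leq_maxl.
    by apply: lt_le_trans y0 _; rewrite ler_nat leq_maxr.
  exists n => //; split; rewrite /= in_itv/=.
    by move: nx; rewrite ltr_norml => /andP[->] /ltW.
  by move: ny; rewrite ltr_norml => /andP[->] /ltW.
move=> n; split; first exact: measurable_rectangle.
rewrite [X in (X < _)%E](_ : _ = ((n%:R - - n%:R) * (n%:R - - n%:R))%:E) ?ltry//.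
have n0 : - n%:R <= n%:R :> R by rewrite -subr_ge0 opprK addr_ge0.
exact: area_rectangle.
Qed.
(** [area R] repackaged with its sigma-finite structure, as required to take its product with itself
    on pairs of points and to apply Fubini. *)
Definition plane_measure (R : realType) : {sigma_finite_measure set (plane R) -> \bar R} :=
  HB.pack_for {sigma_finite_measure set (plane R) -> \bar R} (area R)
   (Measure.on (area R))
   (@Measure_isSigmaFinite.Build _ _ _ (area R) (area_sigma_finite R)).

Lemma integrable_indic_rectangle (R : realType) (a b c d : R) : a <= b -> c <= d ->
  (area R).-integrable setT (EFin \o \1_(rectangle R a b c d)).
Proof.
move=> ab cd; have mQ := measurable_rectangle R a b c d.
apply/integrableP; split; first exact/measurable_EFinP/measurable_indic.
under eq_integral do rewrite gee0_abs ?lee_fin//.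
rewrite integral_indic// setIT [X in (X < _)%E](_ : _ = ((b - a) * (d - c))%:E) ?ltry//.
exact: area_rectangle.
Qed.

Lemma Rintegral_indic_rectangle (R : realType) (a b c d : R) : a <= b -> c <= d ->
  \int[area R]_q \1_(rectangle R a b c d) q = (b - a) * (d - c).
Proof.
move=> ab cd; have mQ := measurable_rectangle R a b c d.
by rewrite /Rintegral integral_indic// setIT [X in fine X](area_rectangle _ _ _ _ _ ab cd).
Qed.

(** * Pairings through a kernel and approximate identities *)

Section tensor_pairing.
Context {d} {T : measurableType d} {R : realType}.
Variable mu : {sigma_finite_measure set T -> \bar R}.
Implicit Types (a b : T -> R) (K : T * T -> R).

Definition pairing b a K : R := \int[(mu \x mu)%E]_x (b x.1 * a x.2 * K x).

Lemma measurable_tensor b a : measurable_fun setT b -> measurable_fun setT a ->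
  measurable_fun setT (fun x : T * T => b x.1 * a x.2).
Proof. by move=> mb ma; apply: measurable_funM; exact: measurableT_comp. Qed.

Lemma integrable_tensor b a :
  mu.-integrable setT (EFin \o b) -> mu.-integrable setT (EFin \o a) ->
  (mu \x mu)%E.-integrable setT (fun x => (b x.1 * a x.2)%:E).
Proof.
move=> ib ia.
have mb : measurable_fun setT b by apply/measurable_EFinP; exact: measurable_int ib.
have ma : measurable_fun setT a by apply/measurable_EFinP; exact: measurable_int ia.
apply/integrable12ltyP; first by apply/measurable_EFinP; exact: measurable_tensor.
have ia' := integrable_fin_num measurableT (integrable_abse ia).
rewrite (eq_integral (fun q => ((\int[mu]_p `|(a p)%:E|) * `|(b q)%:E|)%E)); last first.
  move=> q _.
  rewrite (eq_integral (fun p => (`|b q|%:E * `|(a p)%:E|)%E)); last first.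
    by move=> p _; rewrite /= normrM EFinM.
  have mEa : measurable_fun setT (fun p => `|(a p)%:E|)%E.
    by apply: measurableT_comp => //; exact/measurable_EFinP.
  rewrite [LHS](ge0_integralZl_EFin mu measurableT _ mEa)//.
  exact: muleC.
rewrite ge0_integralZl//.
- apply: lte_mul_pinfty => //; first exact: integral_ge0.
  by have /integrableP[] := ib.
- by apply: measurableT_comp => //; exact/measurable_EFinP.
- exact: integral_ge0.
Qed.

(** The bound on [g] is asked only on the support of [f]: some kernels below are unbounded on the
    plane. *)
Lemma integrable_bounded_mul d' (T' : measurableType d') (nu : {measure set T' -> \bar R})
    (f g : T' -> R) (C : R) :
  nu.-integrable setT (EFin \o f) -> measurable_fun setT g ->
  (forall x, f x != 0 -> `|g x| <= C) -> nu.-integrable setT (fun x => (f x * g x)%:E).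
Proof.
move=> if_ mg gC.
have mf : measurable_fun setT f by apply/measurable_EFinP; exact: measurable_int if_.
apply: (@le_integrable _ _ _ nu setT measurableT _ (fun x => (C%:E * (f x)%:E)%E)) => //.
- by apply/measurable_EFinP; exact: measurable_funM.
- move=> x _; rewrite -EFinM !abse_EFin lee_fin !normrM.
  have [->|fx] := eqVneq (f x) 0; first by rewrite normr0 mul0r mulr0.
  rewrite mulrC ler_wpM2r//; apply: le_trans (gC _ fx) (ler_norm _).
- exact: integrableZl.
Qed.

Section pairing_theory.
Variables (b a : T -> R) (K : T * T -> R) (C : R).
Hypotheses (ib : mu.-integrable setT (EFin \o b))
  (ia : mu.-integrable setT (EFin \o a)) (mK : measurable_fun setT K)
  (KC : forall q p, b q != 0 -> a p != 0 -> `|K (q, p)| <= C).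

Lemma integrable_pairing :
  (mu \x mu)%E.-integrable setT (fun x => (b x.1 * a x.2 * K x)%:E).
Proof.
apply: (integrable_bounded_mul _ _ _ _ _ C) => //; first exact: integrable_tensor.
by move=> [q p] /=; rewrite mulf_eq0 negb_or => /andP[]; exact: KC.
Qed.

Lemma pairing12 : pairing b a K = \int[mu]_q (b q * \int[mu]_p (a p * K (q, p))).
Proof.
rewrite /pairing /Rintegral -(integral12_prod_meas1 integrable_pairing); congr fine.
apply: eq_integral => q _; rewrite /fubini_F /=.
(* Where [b q] vanishes, [KC] says nothing about the inner integrand, but both sides are zero. *)
have [bq|bq] := eqVneq (b q) 0.
  by under eq_integral do rewrite bq !mul0r; rewrite integral0 bq mul0r.
have iK : mu.-integrable setT (fun p => (a p * K (q, p))%:E).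
  apply: (integrable_bounded_mul _ _ _ _ _ C) => //; first exact: measurable_fun_pair2.
  by move=> p ap; exact: KC.
under eq_integral do rewrite -mulrA EFinM.
by rewrite integralZl// EFinM fineK//; exact: integrable_fin_num.
Qed.

Lemma pairing21 : pairing b a K = \int[mu]_p (a p * \int[mu]_q (b q * K (q, p))).
Proof.
rewrite /pairing /Rintegral -(integral21_prod_meas1 integrable_pairing); congr fine.
apply: eq_integral => p _; rewrite /fubini_G /=.
have [ap|ap] := eqVneq (a p) 0.
  by under eq_integral do rewrite ap mulr0 mul0r; rewrite integral0 ap mul0r.
have iK : mu.-integrable setT (fun q => (b q * K (q, p))%:E).
  apply: (integrable_bounded_mul _ _ _ _ _ C) => //; first exact: measurable_fun_pair1.
  by move=> q bq; exact: KC.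
under eq_integral do rewrite mulrAC mulrC EFinM.
by rewrite integralZl// EFinM fineK//; exact: integrable_fin_num.
Qed.

End pairing_theory.

(** * Concentrating kernels *)

Section approximate_identity.
Variables (tau : T -> T -> T) (sub : T -> T -> T).
Hypotheses (ptau : forall z, measure_preserving mu (tau z))
  (mtau : measurable_fun setT (fun x : T * T => tau x.1 x.2))
  (msub : measurable_fun setT (fun x : T * T => sub x.1 x.2))
  (tauC : forall z q, tau z q = tau q z) (tauK : forall z q, sub (tau z q) q = z).
Variables (a b rho : T -> R) (C eps : R).
Hypotheses (ia : mu.-integrable setT (EFin \o a))
  (ib : mu.-integrable setT (EFin \o b))
  (iab : mu.-integrable setT (fun q => (a q * b q)%:E))
  (irho : mu.-integrable setT (EFin \o rho)).
Hypotheses (rho0 : forall z, 0 <= rho z) (rhoC : forall z, rho z <= C).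
Hypothesis near_rho : forall z, rho z != 0 ->
  (\int[mu]_q (`|(a (tau z q) - a q) * b q|)%:E <= eps%:E)%E.

Let ma : measurable_fun setT a.
Proof. by apply/measurable_EFinP; exact: measurable_int ia. Qed.

Let mb : measurable_fun setT b.
Proof. by apply/measurable_EFinP; exact: measurable_int ib. Qed.

Let mrho : measurable_fun setT rho.
Proof. by apply/measurable_EFinP; exact: measurable_int irho. Qed.

Let norm_rho z : `|rho z| <= C. Proof. by rewrite ger0_norm. Qed.

Let matau : measurable_fun setT (fun x : T * T => a (tau x.2 x.1)).
Proof.
rewrite (_ : (fun x : T * T => _) = a \o (fun x : T * T => tau x.1 x.2)).
  exact: measurableT_comp.
by apply/funext => x /=; rewrite tauC.
Qed.

Let integrable_shear :
  (mu \x mu)%E.-integrable setT (fun x => (b x.1 * a (tau x.2 x.1))%:E).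
Proof.
apply/integrable12ltyP.
  apply/measurable_EFinP; apply: measurable_funM => //; exact: measurableT_comp.
rewrite (eq_integral (fun q => \int[mu]_z `|(b q * a z)%:E|)%E).
  have mt : measurable_fun setT (fun x : T * T => (b x.1 * a x.2)%:E).
    by apply/measurable_EFinP; exact: measurable_tensor.
  exact: ((integrable12ltyP mu mu mt).1 (integrable_tensor b a ib ia)).
move=> q _ /=.
rewrite -[RHS](ge0_integral_preserving mu _ (ptau q) (fun z => `|b q * a z|%:E))//.
  by apply: eq_integral => z _; rewrite tauC.
by apply/measurable_EFinP/measurableT_comp => //; exact: measurable_funM.
Qed.

Let D1 (x : T * T) := b x.1 * a (tau x.2 x.1) * rho x.2.
Let D2 (x : T * T) := (a x.1 * b x.1) * rho x.2.

Let iD1 : (mu \x mu)%E.-integrable setT (EFin \o D1).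
Proof.
apply: (integrable_bounded_mul _ _ _ _ (fun x : T * T => rho x.2) C) => //.
exact: measurableT_comp.
Qed.

Let iD2 : (mu \x mu)%E.-integrable setT (EFin \o D2).
Proof. exact: (integrable_tensor (fun q => a q * b q)). Qed.

(** For fixed [q] the substitution of [tau q z] for the second point preserves [mu] and turns the
    kernel into [rho z]. *)
Let pairing_shear :
  pairing b a (fun x => rho (sub x.2 x.1)) = \int[(mu \x mu)%E]_x D1 x.
Proof.
have mr : measurable_fun setT (fun x : T * T => rho (sub x.2 x.1)).
  rewrite (_ : (fun x : T * T => _) = rho \o (fun x => sub x.1 x.2) \o (fun x => (x.2, x.1)))//.
  apply: measurableT_comp; first exact: measurableT_comp.
  exact: measurable_fun_pair.
have ipair := integrable_pairing b a (fun x => rho (sub x.2 x.1)) C ib ia mr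
  (fun q p _ _ => norm_rho _).
rewrite /pairing /Rintegral -(integral12_prod_meas1 ipair) -(integral12_prod_meas1 iD1).
congr fine; apply: eq_integral => q _; rewrite /fubini_F /= /D1 /=.
have ip : mu.-integrable setT (fun p => (b q * a p * rho (sub p q))%:E).
  apply: (integrable_bounded_mul _ _ _ (fun p => b q * a p) _ C) => //.
    exact: (integrableZl measurableT (b q) ia).
  exact: measurable_fun_pair2 mr.
rewrite -(integral_preserving mu _ (ptau q) _ ip).
by apply: eq_integral => z _; rewrite tauC tauK.
Qed.

(** In the sheared coordinates the error is an average, with weight [rho z], of quantities that
    [near_rho] bounds by [eps]. The mass of [rho] stays on both sides, so the kernel need not be
    normalised. *)
Lemma pairing_approximate_identity :
  `|pairing b a (fun x => rho (sub x.2 x.1)) -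
    (\int[mu]_q (a q * b q)) * \int[mu]_z rho z| <= eps * \int[mu]_z rho z.
Proof.
have D2E : \int[(mu \x mu)%E]_x D2 x = (\int[mu]_q (a q * b q)) * \int[mu]_z rho z.
  have -> : \int[(mu \x mu)%E]_x D2 x = pairing (fun q => a q * b q) rho (fun=> 1).
    by apply: eq_Rintegral => x _; rewrite /D2 mulr1.
  rewrite (pairing12 _ _ _ 1)//; last by move=> *; rewrite normr1.
  under eq_Rintegral do under eq_Rintegral do rewrite mulr1.
  by rewrite RintegralZr.
rewrite -D2E pairing_shear -RintegralB//.
have iD : (mu \x mu)%E.-integrable setT (fun x => (D1 x - D2 x)%:E).
  exact: (integrableB measurableT iD1 iD2).
have mD := measurable_int _ iD.
rewrite -lee_fin EFinM.
apply: (@le_trans _ _ (\int[(mu \x mu)%E]_x `|(D1 x - D2 x)%:E|)%E).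
  by rewrite EFin_normr_Rintegral//; exact: le_abse_integral.
(* Integrating over [q] first leaves, for each [z], [rho z] times the integral controlled by
   [near_rho]. *)
rewrite fubini_tonelli2//; last exact: measurableT_comp.
have frho : (\int[mu]_z (rho z)%:E)%E \is a fin_num by exact: integrable_fin_num.
rewrite /Rintegral fineK// -integralZl//.
apply: ge0_le_integral => //.
- by move=> z _; exact: integral_ge0.
- by apply: measurable_fun_fubini_tonelli_G => //; exact: measurableT_comp.
- by apply: measurable_funeM; exact/measurable_EFinP.
move=> z _; rewrite /fubini_G.
rewrite (eq_integral (fun q => ((rho z)%:E * `|(a (tau z q) - a q) * b q|%:E)%E)); last first.
  move=> q _; rewrite /D1 /D2/= -EFinM; congr EFin.
  rewrite -[in RHS](ger0_norm (rho0 z)) -normrM; congr (`|_|); ring.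
rewrite ge0_integralZl_EFin//.
- have [->|rz] := eqVneq (rho z) 0; first by rewrite mul0e mule0.
  by rewrite muleC lee_wpmul2r ?lee_fin// near_rho.
- apply/measurable_EFinP; apply: measurableT_comp => //; apply: measurable_funM => //.
  apply: measurable_funB => //; apply: measurableT_comp => //.
  by have [] := ptau z.
Qed.

End approximate_identity.
End tensor_pairing.

(** * Test functions of product form *)

Section test_functions.
Context (R : realType).
Implicit Types (F G : R -> R) (p q : R * R).

(** The derivative is an explicit argument, since the proof tracks which derivative of each factor
    enters the kernel. *)
Definition C1_line F F' := (forall x : R, is_derive x 1 F (F' x)) /\ continuous F'.

Lemma C1_line_continuous F F' : C1_line F F' -> continuous F.
Proof.
move=> [dF _] x; apply: differentiable_continuous.
by apply/derivable1_diffP; have [] := dF x.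
Qed.

Lemma C1_line_reflect F F' s : C1_line F F' ->
  C1_line (fun x => F (s - x)) (fun x => - F' (s - x)).
Proof.
move=> [dF cF']; split => x.
  have dsx : is_derive x 1 (fun x : R => s - x) (0 - 1) by exact: is_deriveB.
  rewrite (_ : - F' (s - x) = F' (s - x) * (0 - 1)); last by rewrite sub0r mulrN1.
  exact: (@is_derive1_comp R F (fun x => s - x) x _ _ (dF (s - x)) dsx).
apply: continuousN; apply: (@continuous_comp _ _ _ (fun x => s - x) F'); last exact: cF'.
by apply: continuousB => //; exact: cst_continuous.
Qed.

Lemma C1_line_shift F F' s : C1_line F F' ->
  C1_line (fun x => F (x - s)) (fun x => F' (x - s)).
Proof.
move=> [dF cF']; split => x.
  have dsx : is_derive x 1 (fun x : R => x - s) (1 - 0) by exact: is_deriveB.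
  rewrite (_ : F' (x - s) = F' (x - s) * (1 - 0)); last by rewrite subr0 mulr1.
  exact: (@is_derive1_comp R F (fun x => x - s) x _ _ (dF (x - s)) dsx).
apply: (@continuous_comp _ _ _ (fun x => x - s) F'); last exact: cF'.
by apply: continuousB => //; exact: cst_continuous.
Qed.

Lemma partial_tensor F F' G G' p : C1_line F F' -> C1_line G G' ->
  [/\ differentiable (fun q => F q.1 * G q.2) p,
      partial 0 (fun q => F q.1 * G q.2) p = F' p.1 * G p.2 &
      partial 1 (fun q => F q.1 * G q.2) p = F p.1 * G' p.2].
Proof.
move=> [dF cF'] [dG cG'].
have c1 : continuous (fst : R * R -> R) by move=> ?; exact: cvg_fst.
have c2 : continuous (snd : R * R -> R) by move=> ?; exact: cvg_snd.
have d1 : differentiable (fst : R * R -> R) p.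
  exact: (linear_differentiable (f := (fst : {linear (R * R)%type -> R^o}))).
have d2 : differentiable (snd : R * R -> R) p.
  exact: (linear_differentiable (f := (snd : {linear (R * R)%type -> R^o}))).
have dFp : differentiable F p.1 by apply/derivable1_diffP; have [] := dF p.1.
have dGp : differentiable G p.2 by apply/derivable1_diffP; have [] := dG p.2.
have dF1 : differentiable (F \o fst) p by exact: differentiable_comp.
have dG2 : differentiable (G \o snd) p by exact: differentiable_comp.
have vF v : derivable (F \o fst) p v by exact: diff_derivable.
have vG v : derivable (G \o snd) p v by exact: diff_derivable.
have F1 : 'D_(1, 0) (F \o fst) p = F' p.1.
  (* By conversion, the directional derivative of a function of one coordinate is its one-variable
     derivative along that coordinate of the direction, here [1], and [0] in the mixed cases. *)
  by rewrite [LHS](_ : _ = 'D_1 F p.1)//; have [] := dF p.1.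
have F2 : 'D_(0, 1) (F \o fst) p = 0.
  by rewrite [LHS](_ : _ = 'D_0 F p.1)// derive0.
have G1 : 'D_(1, 0) (G \o snd) p = 0.
  by rewrite [LHS](_ : _ = 'D_0 G p.2)// derive0.
have G2 : 'D_(0, 1) (G \o snd) p = G' p.2.
  by rewrite [LHS](_ : _ = 'D_1 G p.2)//; have [] := dG p.2.
split.
- exact: (differentiableM dF1 dG2).
- transitivity ('D_(1, 0) ((F \o fst) * (G \o snd)) p) => //.
  by rewrite (deriveM (vF _) (vG _)) F1 G1 scaler0 add0r mulrC.
- transitivity ('D_(0, 1) ((F \o fst) * (G \o snd)) p) => //.
  by rewrite (deriveM (vF _) (vG _)) F2 G2 scaler0 addr0.
Qed.

Lemma C1_plane_tensor F F' G G' : C1_line F F' -> C1_line G G' ->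
  C1_plane (fun q => F q.1 * G q.2).
Proof.
move=> CF CG.
have c1 (H : R -> R) : continuous H -> continuous (fun q : R * R => H q.1).
  by move=> cH q; apply: (@continuous_comp _ _ _ fst H); [exact: cvg_fst|exact: cH].
have c2 (H : R -> R) : continuous H -> continuous (fun q : R * R => H q.2).
  by move=> cH q; apply: (@continuous_comp _ _ _ snd H); [exact: cvg_snd|exact: cH].
split=> [p|j]; first by have [] := partial_tensor _ _ _ _ p CF CG.
have [->|->] : j = 0 \/ j = 1.
  by case: j => [[|[|]]] // ?; [left|right]; exact: val_inj.
- rewrite (_ : partial _ _ = fun q => F' q.1 * G q.2).
    move=> q; apply: continuousM; first by apply: c1; case: CF.
    by apply: c2; exact: C1_line_continuous CG.
  by apply/funext => p; have [] := partial_tensor _ _ _ _ p CF CG.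
- rewrite (_ : partial _ _ = fun q => F q.1 * G' q.2).
    move=> q; apply: continuousM; last by apply: c2; case: CG.
    by apply: c1; exact: C1_line_continuous CF.
  by apply/funext => p; have [] := partial_tensor _ _ _ _ p CF CG.
Qed.

Lemma C1_plane_cst (c : R) : C1_plane (fun=> c).
Proof.
split=> [p|j]; first exact: differentiable_cst.
rewrite (_ : partial _ _ = fun=> 0); first by move=> ?; exact: cvg_cst.
by apply/funext => p; exact: derive_cst.
Qed.

Lemma continuous_bounded_line F M : continuous F ->
  exists C, forall x, `|x| <= M -> `|F x| <= C.
Proof.
move=> cF; have [M0|M0] := leP 0 M; last first.
  by exists 0 => x xM; have := le_lt_trans xM M0; rewrite normr_lt0.
have cnF : continuous (fun x => `|F x|).
  by move=> x; apply: continuous_comp; [exact: cF|exact: norm_continuous].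
have [] := @EVT_max R (fun x => `|F x|) (- M) M; first lra.
  exact: continuous_subspaceT.
move=> c _ cmax; exists `|F c| => x xM; apply: cmax.
by rewrite in_itv/= -ler_norml.
Qed.

(** Its powers are the truncated powers of spline theory, from which both bumps are built. *)
Definition pospart (x : R) := Num.max 0 x.

Lemma pospart_ge0 x : 0 <= pospart x. Proof. by rewrite le_max lexx. Qed.

Lemma pospart_id x : 0 <= x -> pospart x = x.
Proof. by move=> x0; apply/max_idPr. Qed.

Lemma pospart_eq0 x : x <= 0 -> pospart x = 0.
Proof. by move=> x0; apply/max_idPl. Qed.

Lemma pospart_continuous : continuous pospart.
Proof.
rewrite (_ : pospart = fun x => (x + `|x|) / 2).
  move=> x; apply: cvgMr_tmp; apply: cvgD; first exact: cvg_id.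
  exact: norm_continuous.
apply/funext => x; have [x0|x0] := leP 0 x.
  by rewrite pospart_id// ger0_norm//; lra.
by rewrite (pospart_eq0 _ (ltW x0)) ltr0_norm//; lra.
Qed.

(** The remainder after the linear term is at most [h ^+ 2], whatever the signs of [x] and
    [h + x]. *)
Lemma is_derive_pospart2 (x : R) : is_derive x 1 (fun y => pospart y ^+ 2) (2 * pospart x).
Proof.
have bnd h : `|pospart (h + x) ^+ 2 - pospart x ^+ 2 - h * (2 * pospart x)| <= h ^+ 2.
  rewrite ler_norml; have [x0|x0] := leP 0 x; have [hx0|hx0] := leP 0 (h + x).
  - by rewrite !pospart_id//; apply/andP; split; nra.
  - by rewrite (pospart_id x)// (pospart_eq0 _ (ltW hx0)); apply/andP; split; nra.
  - by rewrite (pospart_id (h + x))// (pospart_eq0 _ (ltW x0)); apply/andP; split; nra.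
  - by rewrite (pospart_eq0 _ (ltW hx0)) (pospart_eq0 _ (ltW x0)); apply/andP; split; nra.
have lim : h^-1 *: (pospart (h *: 1 + x) ^+ 2 - pospart x ^+ 2) @[h --> 0^'] --> 2 * pospart x.
  apply/cvgrPdist_le => e e0; near=> h.
  have h0 : h != 0 by near: h; exact: nbhs_dnbhs_neq.
  have he : `|h| <= e.
    near: h; apply: nbhs_dnbhs; apply/nbhs_ballP; exists e => //= h.
    by rewrite /ball/= sub0r normrN => /ltW.
  rewrite -(ler_pM2l (_ : 0 < `|h|)) ?normr_gt0//.
  have -> : h *: (1 : R) = h by rewrite /GRing.scale/= mulr1.
  rewrite -normrM mulrBr [h^-1 *: _]/(_ * _) mulVKf// -normrN opprB.
  apply: le_trans (bnd h) _.
  rewrite -[h ^+ 2]ger0_norm ?sqr_ge0// expr2 normrM.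
  by rewrite ler_pM2l ?normr_gt0.
apply: DeriveDef; last exact: (cvg_lim _ lim).
by apply/cvg_ex; exists (2 * pospart x).
Unshelve. all: by end_near. Qed.

(** The truncated cube is [x] times the truncated square, so the product rule suffices. *)
Lemma is_derive_pospart3 (x : R) : is_derive x 1 (fun y => pospart y ^+ 3) (3 * pospart x ^+ 2).
Proof.
have xp y : y * pospart y = pospart y ^+ 2.
  have [y0|y0] := leP 0 y; first by rewrite pospart_id.
  by rewrite (pospart_eq0 _ (ltW y0)) mulr0 expr0n.
rewrite (_ : (fun y => _) = id * (fun y => pospart y ^+ 2)); last first.
  apply/funext => y; rewrite [RHS](_ : _ = y * pospart y * pospart y).
    by rewrite xp -exprSr.
  by rewrite -mulrA -expr2.
have d2 := is_derive_pospart2 x.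
apply: is_derive_eq; rewrite /GRing.scale/=.
rewrite mulrCA xp; ring.
Qed.

Lemma C1_line_pospart2 : C1_line (fun y => pospart y ^+ 2) (fun x => 2 * pospart x).
Proof.
split; first exact: is_derive_pospart2.
by move=> x; apply: cvgMl_tmp; exact: pospart_continuous.
Qed.

Lemma C1_line_pospart3 : C1_line (fun y => pospart y ^+ 3) (fun x => 3 * pospart x ^+ 2).
Proof.
split; first exact: is_derive_pospart3.
move=> x; apply: cvgMl_tmp.
exact: (C1_line_continuous _ _ C1_line_pospart2).
Qed.

Lemma C1_lineD F F' G G' : C1_line F F' -> C1_line G G' ->
  C1_line (fun x => F x + G x) (fun x => F' x + G' x).
Proof.
move=> [dF cF] [dG cG]; split=> x; last by apply: cvgD; [exact: cF|exact: cG].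
exact: is_deriveD.
Qed.

Lemma C1_lineM F F' G G' : C1_line F F' -> C1_line G G' ->
  C1_line (fun x => F x * G x) (fun x => F x * G' x + G x * F' x).
Proof.
move=> CF CG; have cF := C1_line_continuous _ _ CF; have cG := C1_line_continuous _ _ CG.
case: CF CG => [dF cF'] [dG cG']; split=> x; first exact: is_deriveM.
by apply: cvgD; apply: cvgM; [exact: cF|exact: cG'|exact: cG|exact: cF'].
Qed.

Lemma C1_line_cst c : C1_line (fun=> c) (fun=> 0).
Proof. by split=> x; [exact: is_derive_cst|exact: cst_continuous]. Qed.

Lemma C1_line_id : C1_line id (fun=> 1).
Proof. by split=> x; [exact: is_derive_id|exact: cst_continuous]. Qed.

Lemma C1_line_comp F F' G G' : C1_line F F' -> C1_line G G' ->
  C1_line (fun x => F (G x)) (fun x => F' (G x) * G' x).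
Proof.
move=> [dF cF'] CG; have cG := C1_line_continuous _ _ CG.
case: CG => dG cG'; split=> x; first exact: (@is_derive1_comp R F G x _ _ (dF (G x)) (dG x)).
apply: cvgM; last exact: cG'.
by apply: (@continuous_comp _ _ _ G F'); [exact: cG|exact: cF'].
Qed.

End test_functions.

(** * Bumps with two derivatives or two antiderivatives *)

Section bumps.
Context (R : realType).
Implicit Types F : R -> R.

Lemma eq_C1_line F F' G' : F' =1 G' -> C1_line _ F F' -> C1_line R F G'.
Proof. by move=> /funext ->. Qed.

Lemma C1_lineZ c F F' : C1_line _ F F' -> C1_line R (fun x => c * F x) (fun x => c * F' x).
Proof.
move=> CF; apply: eq_C1_line (C1_lineM _ _ _ _ _ (C1_line_cst _ c) CF) => x.
by rewrite mulr0 addr0.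
Qed.

Lemma C1_lineN F F' : C1_line _ F F' -> C1_line R (fun x => - F x) (fun x => - F' x).
Proof.
move=> CF; have := C1_lineZ (-1) _ _ CF.
by congr C1_line; apply/funext => x; rewrite mulN1r.
Qed.

(** The lower bound on the inner half of the interval is there to make the total mass of the kernel
    positive. *)
Definition is_bump (d : R) F :=
  [/\ forall x, 0 <= F x, forall x, F x != 0 -> `|x| < d, exists C, forall x, F x <= C &
     exists2 k, 0 < k & forall x, `|x| <= d / 2 -> k <= F x].

(** The function is the truncated cube of [d^2 - x^2]; the third power leaves a continuous second
    derivative at the endpoints. *)
Lemma bump_with_derivatives (d : R) : 0 < d -> exists F0 F1 F2 : R -> R,
  [/\ C1_line _ F0 F1, C1_line _ F1 F2 & is_bump d F0].
Proof.
move=> d0; pose u (x : R) := d ^+ 2 + -1 * (x * x).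
have Cu : C1_line _ u (fun x => -2 * x).
  apply: eq_C1_line (C1_lineD _ _ _ _ _ (C1_line_cst _ (d ^+ 2))
    (C1_lineZ (-1) _ _ (C1_lineM _ _ _ _ _ (C1_line_id R) (C1_line_id R)))) => x /=.
  ring.
have C3 := C1_line_comp _ _ _ _ _ (C1_line_pospart3 R) Cu.
have C2 := C1_lineM _ _ _ _ _
  (C1_lineZ 3 _ _ (C1_line_comp _ _ _ _ _ (C1_line_pospart2 R) Cu))
  (C1_lineZ (-2) _ _ (C1_line_id R)).
have ud x : u x <= d ^+ 2 by rewrite /u; have := sqr_ge0 x; nra.
have pud x : pospart R (u x) <= d ^+ 2 by rewrite ge_max ud sqr_ge0.
do 3 eexists; split; [exact: C3|exact: C2|split].
- by move=> x; rewrite exprn_ge0// pospart_ge0.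
- move=> x; apply: contraNT; rewrite -leNgt => dx.
  rewrite pospart_eq0 ?expr0n// /u.
  have -> : x * x = `|x| * `|x| by rewrite -normrM ger0_norm// -expr2 sqr_ge0.
  have := ler_pM (ltW d0) (ltW d0) dx dx; rewrite expr2; lra.
- by exists ((d ^+ 2) ^+ 3) => x; rewrite lerXn2r// nnegrE ?pospart_ge0 ?sqr_ge0.
(* On the inner half [x^2 <= d^2 / 4], hence [u x >= 3 / 4 * d ^+ 2]. *)
exists ((3 / 4 * d ^+ 2) ^+ 3).
  by rewrite exprn_gt0// mulr_gt0 ?exprn_gt0//; lra.
move=> x xd; have ux : 3 / 4 * d ^+ 2 <= u x.
  rewrite /u; have -> : x * x = `|x| * `|x|.
    by rewrite -normrM ger0_norm// -expr2 sqr_ge0.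
  have := ler_pM (normr_ge0 x) (normr_ge0 x) xd xd; rewrite expr2; lra.
have u0 : 0 <= 3 / 4 * d ^+ 2 by rewrite mulr_ge0 ?sqr_ge0//; lra.
by rewrite pospart_id ?lerXn2r ?nnegrE//; apply: le_trans ux.
Qed.

Let second_difference d F (x : R) := F (x - - d) + (-2 * F x + F (x - d)).

Let C1_line_second_difference d F F' : C1_line _ F F' ->
  C1_line _ (second_difference d F) (second_difference d F').
Proof.
move=> CF; apply: (C1_lineD _ _ _ _ _ (C1_line_shift _ _ _ _ CF)).
exact: (C1_lineD _ _ _ _ _ (C1_lineZ _ _ _ CF) (C1_line_shift _ _ _ _ CF)).
Qed.

(* G0 is the second difference of the truncated cubic, so that G2 is a hat
   function. *)
Lemma bump_with_antiderivatives (d : R) : 0 < d -> exists G0 G1 G2 : R -> R,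
  [/\ C1_line _ G0 G1, C1_line _ G1 G2 & is_bump d G2].
Proof.
move=> d0; have C3 := C1_line_second_difference d _ _ (C1_line_pospart3 R).
have C2 := C1_line_second_difference d _ _ (C1_lineZ 3 _ _ (C1_line_pospart2 R)).
do 3 eexists; split; [exact: C3|exact: C2|].
have E x : second_difference d (fun x => 3 * (2 * pospart R x)) x =
    if `|x| < d then 6 * (d - `|x|) else 0.
  rewrite /second_difference opprK.
  have [x0|x0] := leP 0 x.
    have -> : pospart R (x + d) = x + d by apply: pospart_id; lra.
    rewrite (ger0_norm x0) (pospart_id _ x x0); case: ltP => xd.
      have -> : pospart R (x - d) = 0 by apply: pospart_eq0; lra.
      lra.
    have -> : pospart R (x - d) = x - d by apply: pospart_id; lra.
    lra.
  have -> : pospart R (x - d) = 0 by apply: pospart_eq0; lra.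
  rewrite (ltr0_norm x0) (pospart_eq0 _ x (ltW x0)); case: ltP => xd.
    have -> : pospart R (x + d) = x + d by apply: pospart_id; lra.
    lra.
  have -> : pospart R (x + d) = 0 by apply: pospart_eq0; lra.
  lra.
split.
- by move=> x; rewrite E; case: ltP => // xd; lra.
- by move=> x; rewrite E; case: ltP => //; rewrite eqxx.
- by exists (6 * d) => x; rewrite E; have := normr_ge0 x; case: ltP => // ? ?; lra.
- exists (3 * d); first lra.
  move=> x xd; have xltd : `|x| < d by lra.
  by rewrite E xltd; lra.
Qed.

End bumps.

(** * Zero extensions of residual stresses *)

Section zero_extension.
Context (R : realType) (Omega : set (R * R)) (M : R) (sigma : R * R -> 'M[R]_2).
Hypotheses (Omega_meas : measurable Omega)
  (Omega_bounded : forall p, Omega p -> `|p.1| <= M /\ `|p.2| <= M)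
  (stress : residual_stress Omega sigma).

Definition extension (i j : 'I_2) : plane R -> R := (fun p => sigma p i j) \_ Omega.

Lemma extension_supp i j q : extension i j q != 0 -> `|q.1| <= M /\ `|q.2| <= M.
Proof.
rewrite /extension patchE; case: ifPn => [|_]; last by rewrite eqxx.
by rewrite inE => + _; exact: Omega_bounded.
Qed.

Lemma extension_sym i j : extension i j = extension j i.
Proof.
apply/funext => q; rewrite /extension !patchE; case: ifPn => //; rewrite inE => Oq.
by have [/(_ _ Oq) {1}<- _ _] := stress; rewrite mxE.
Qed.

Lemma measurable_extension i j : measurable_fun setT (extension i j).
Proof.
have [_ /(_ i j)[_ ms] _] := stress.
exact: (measurable_restrictT _ _).1.
Qed.

Lemma sqnorm_extension i j : (sqnorm (area R) (extension i j) < +oo)%E.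
Proof.
have [_ /(_ i j)[/integrableP[_ is_] _] _] := stress.
apply: le_lt_trans is_; rewrite integral_mkcond /sqnorm le_eqVlt; apply/orP; left.
apply/eqP; apply: eq_integral => q _; rewrite /extension /= !patchE.
case: ifPn => _; last by rewrite expr0n.
by rewrite ger0_norm ?sqr_ge0.
Qed.

(** Square integrability gives integrability on a bounded set, by [|s| <= 1 + s^2] on a box
    containing Omega. *)
Lemma integrable_extension i j :
  (area R).-integrable setT (EFin \o extension i j).
Proof.
(* [M] carries no sign, whereas the box needs ordered sides; the later [+ 1] yields the strict
   bounds required by half-open sides. *)
have [N [MN N0]] : exists N : R, M <= N /\ 0 <= N.
  by exists `|M|; rewrite ler_norm normr_ge0.
have MN1 (x : R) : `|x| <= M -> - (N + 1) < x <= N + 1.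
  by rewrite ler_norml => /andP[? ?]; apply/andP; split; lra.
pose Q := rectangle R (- (N + 1)) (N + 1) (- (N + 1)) (N + 1).
have ms := measurable_extension i j.
have soo := sqnorm_extension i j.
apply: (@le_integrable _ _ _ (area R) setT measurableT _
  (fun q => (\1_Q q)%:E + ((extension i j q) ^+ 2)%:E)%E).
- exact/measurable_EFinP.
- move=> q _; rewrite /= lee_fin.
  have [->|sq] := eqVneq (extension i j q) 0; first by rewrite normr0.
  have [q1 q2] := extension_supp _ _ _ sq.
  rewrite indicE mem_set; last first.
    by split; rewrite /= in_itv/=; exact: MN1.
  rewrite -[in leRHS]real_normK ?num_real//.
  rewrite (_ : true%:R = 1)//; apply: le_trans (ler_norm _).
  by have := sqr_ge0 (`|extension i j q| - 1); have := sqr_ge0 `|extension i j q|; lra.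
apply: integrableD => //.
  by apply: integrable_indic_rectangle; lra.
apply/integrableP; split; first by apply/measurable_EFinP; exact: measurable_funX.
by under eq_integral do rewrite gee0_abs ?lee_fin ?sqr_ge0//.
Qed.

Lemma integrable_extension_test i j (F G : R -> R) : continuous F -> continuous G ->
  (area R).-integrable setT (fun q => (extension i j q * (F q.1 * G q.2))%:E).
Proof.
move=> cF cG; have [CF FC] := continuous_bounded_line _ F M cF.
have [CG GC] := continuous_bounded_line _ G M cG.
apply: (integrable_bounded_mul _ _ _ _ _ (CF * CG)).
- exact: integrable_extension.
- apply: measurable_funM; apply: measurableT_comp => //.
    exact: continuous_measurable_fun.
  exact: continuous_measurable_fun.
- move=> q /extension_supp [q1 q2]; rewrite normrM ler_pM//; [exact: FC|exact: GC].
Qed.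

(** The test field has [F(x) G(y)] as its [i]-th component and zero as the other, which isolates row
    [i] of the stress. *)
Lemma virtual_work i (F F' G G' : R -> R) : C1_line _ F F' -> C1_line _ G G' ->
  \int[area R]_q (extension i 1 q * (F q.1 * G' q.2)) =
  \int[area R]_q (extension i 0 q * (- F' q.1 * G q.2)).
Proof.
move=> CF CG.
have cF := C1_line_continuous _ _ _ CF; have cG := C1_line_continuous _ _ _ CG.
have cF' : continuous F' by case: CF.
have cG' : continuous G' by case: CG.
have [_ _ vw] := stress.
pose v (k : 'I_2) : R * R -> R := if k == i then (fun q => F q.1 * G q.2) else fun=> 0.
have C1v k : C1_plane (v k).
  by rewrite /v; case: (k == i); [exact: C1_plane_tensor CF CG|exact: C1_plane_cst].
have := vw v C1v; rewrite integral_mkcond.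
rewrite (eq_integral (fun q => (extension i 0 q * (F' q.1 * G q.2) +
  extension i 1 q * (F q.1 * G' q.2))%:E)); last first.
  move=> q _; rewrite /= patchE /extension !patchE; case: ifPn => // _; last first.
    by rewrite !mul0r addr0.
  congr EFin; rewrite (bigD1 i)//= [X in _ + X]big1 ?addr0; last first.
    move=> k ki; rewrite big1// => j _; rewrite /v (negbTE ki).
    by rewrite /partial derive_cst mulr0.
  have [_ p0 p1] := partial_tensor _ _ _ _ _ q CF CG.
  rewrite big_ord_recl big_ord1 /v eqxx p0.
  by rewrite (_ : lift ord0 ord0 = 1 :> 'I_2) ?p1//; exact: val_inj.
move=> H; have : \int[area R]_q (extension i 0 q * (F' q.1 * G q.2)) +
    \int[area R]_q (extension i 1 q * (F q.1 * G' q.2)) = 0.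
  rewrite -RintegralD//; [|exact: integrable_extension_test..].
  by rewrite /Rintegral H.
move=> /eqP; rewrite addrC addr_eq0 => /eqP ->.
rewrite -mulN1r -RintegralZl//; last exact: integrable_extension_test.
by apply: eq_Rintegral => q _; ring.
Qed.

End zero_extension.

(** * Kernels depending on the difference of two points *)

Definition difference_kernel {R : realType} (F G : R -> R) (x : plane R * plane R) : R :=
  F ((x.2.1 : R) - x.1.1) * G ((x.2.2 : R) - x.1.2).

Definition plane_sub {R : realType} (p q : plane R) : plane R :=
  ((p.1 : R) - q.1, (p.2 : R) - q.2).

Lemma measurable_plane_sub (R : realType) :
  measurable_fun setT (fun x : plane R * plane R => plane_sub x.1 x.2).
Proof.
have m1 : measurable_fun setT (fst : plane R -> measurableTypeR R) by exact: measurable_fst.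
have m2 : measurable_fun setT (snd : plane R -> measurableTypeR R) by exact: measurable_snd.
have n1 : measurable_fun setT (fst : plane R * plane R -> plane R) by exact: measurable_fst.
have n2 : measurable_fun setT (snd : plane R * plane R -> plane R) by exact: measurable_snd.
apply: measurable_fun_pair.
- apply: (@measurable_funB _ _ R _ (fun x : plane R * plane R => x.1.1 : R) (fun x => x.2.1 : R)).
    exact: (measurableT_comp m1 n1).
  exact: (measurableT_comp m1 n2).
- apply: (@measurable_funB _ _ R _ (fun x : plane R * plane R => x.1.2 : R) (fun x => x.2.2 : R)).
    exact: (measurableT_comp m2 n1).
  exact: (measurableT_comp m2 n2).
Qed.

Lemma measurable_translation (R : realType) :
  measurable_fun setT (fun x : plane R * plane R => translation x.1 x.2).
Proof.
have m1 : measurable_fun setT (fst : plane R -> measurableTypeR R) by exact: measurable_fst.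
have m2 : measurable_fun setT (snd : plane R -> measurableTypeR R) by exact: measurable_snd.
have n1 : measurable_fun setT (fst : plane R * plane R -> plane R) by exact: measurable_fst.
have n2 : measurable_fun setT (snd : plane R * plane R -> plane R) by exact: measurable_snd.
apply: measurable_fun_pair.
- apply: (@measurable_funD _ _ R _ (fun x : plane R * plane R => x.2.1 : R) (fun x => x.1.1 : R)).
    exact: (measurableT_comp m1 n2).
  exact: (measurableT_comp m1 n1).
- apply: (@measurable_funD _ _ R _ (fun x : plane R * plane R => x.2.2 : R) (fun x => x.1.2 : R)).
    exact: (measurableT_comp m2 n2).
  exact: (measurableT_comp m2 n1).
Qed.

Lemma measurable_difference_kernel (R : realType) (F G : R -> R) :
  continuous F -> continuous G -> measurable_fun setT (difference_kernel F G).
Proof.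
move=> cF cG; have ms := measurable_plane_sub R.
have sw : measurable_fun setT (fun x : plane R * plane R => (x.2, x.1)).
  by apply: measurable_fun_pair; [exact: measurable_snd|exact: measurable_fst].
have md := measurableT_comp ms sw.
apply: (@measurable_funM _ _ R _ (fun x : plane R * plane R => F ((x.2.1 : R) - x.1.1))
  (fun x => G ((x.2.2 : R) - x.1.2))).
- apply: (measurableT_comp (continuous_measurable_fun cF)).
  exact: (measurableT_comp measurable_fst md).
- apply: (measurableT_comp (continuous_measurable_fun cG)).
  exact: (measurableT_comp measurable_snd md).
Qed.

(** * The pairing of a stress with the cofactor of another *)

Section equilibrium.
Context (R : realType) (Omega : set (R * R)) (M : R).
Hypotheses (Omega_meas : measurable Omega)
  (Omega_bounded : forall p, Omega p -> `|p.1| <= M /\ `|p.2| <= M).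

Definition supported (b : plane R -> R) :=
  forall q, b q != 0 -> `|q.1| <= M /\ `|q.2| <= M.

(** Points of the supports have coordinates bounded by [M], so differences are bounded by [M + M],
    where continuous factors are bounded. *)
Lemma difference_kernel_bound (F G : R -> R) : continuous F -> continuous G ->
  exists C, forall b a : plane R -> R, supported b -> supported a ->
    forall q p, b q != 0 -> a p != 0 -> `|difference_kernel F G (q, p)| <= C.
Proof.
move=> cF cG; have [CF FC] := continuous_bounded_line _ F (M + M) cF.
have [CG GC] := continuous_bounded_line _ G (M + M) cG.
exists (CF * CG) => b a bM aM q p /bM[q1 q2] /aM[p1 p2].
rewrite /difference_kernel/= normrM ler_pM//.
- by apply: FC; apply: le_trans (ler_normB _ _) _; exact: lerD.
- by apply: GC; apply: le_trans (ler_normB _ _) _; exact: lerD.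
Qed.

Variables (sigma : R * R -> 'M[R]_2) (b : plane R -> R).
Hypotheses (stress : residual_stress Omega sigma) (bM : supported b)
  (ib : (area R).-integrable setT (EFin \o b)).
Variables (i : 'I_2) (F F' G G' : R -> R).
Hypotheses (CF : C1_line _ F F') (CG : C1_line _ G G').
Local Notation s := (extension R Omega sigma).

Let sM k l : supported (s k l).
Proof. by move=> q; exact: (extension_supp R Omega M sigma Omega_bounded). Qed.

Let is_ k l : (area R).-integrable setT (EFin \o s k l).
Proof. exact: (integrable_extension R Omega M sigma Omega_meas Omega_bounded stress). Qed.

Let cF : continuous F. Proof. exact: C1_line_continuous CF. Qed.
Let cG : continuous G. Proof. exact: C1_line_continuous CG. Qed.
Let cG' : continuous G'. Proof. by case: CG. Qed.
Let cF' : continuous (fun x => - F' x).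
Proof. by case: (C1_lineN _ _ _ CF). Qed.

(** With the first point [q] frozen, the kernel is a product test function shifted by [q] in the
    second point. *)
Lemma pairing_virtual_work_right :
  pairing (plane_measure R) b (s i 1) (difference_kernel F G') =
  pairing (plane_measure R) b (s i 0) (difference_kernel (fun x => - F' x) G).
Proof.
have [C1 K1] := difference_kernel_bound _ _ cF cG'.
have [C2 K2] := difference_kernel_bound _ _ cF' cG.
have m1 := measurable_difference_kernel R _ _ cF cG'.
have m2 := measurable_difference_kernel R _ _ cF' cG.
rewrite (pairing12 (plane_measure R) b (s i 1) _ C1 ib (is_ i 1) m1 (K1 _ _ bM (sM i 1))).
rewrite (pairing12 (plane_measure R) b (s i 0) _ C2 ib (is_ i 0) m2 (K2 _ _ bM (sM i 0))).
apply: eq_Rintegral => q _; congr (_ * _).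
exact: (virtual_work R Omega M sigma Omega_meas Omega_bounded stress i _ _ _ _
  (C1_line_shift _ _ _ q.1 CF) (C1_line_shift _ _ _ q.2 CG)).
Qed.

Lemma pairing_virtual_work_left :
  pairing (plane_measure R) (s i 1) b (difference_kernel F G') =
  pairing (plane_measure R) (s i 0) b (difference_kernel (fun x => - F' x) G).
Proof.
have [C1 K1] := difference_kernel_bound _ _ cF cG'.
have [C2 K2] := difference_kernel_bound _ _ cF' cG.
have m1 := measurable_difference_kernel R _ _ cF cG'.
have m2 := measurable_difference_kernel R _ _ cF' cG.
rewrite (pairing21 (plane_measure R) (s i 1) b _ C1 (is_ i 1) ib m1 (K1 _ _ (sM i 1) bM)).
rewrite (pairing21 (plane_measure R) (s i 0) b _ C2 (is_ i 0) ib m2 (K2 _ _ (sM i 0) bM)).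
apply: eq_Rintegral => p _; congr (_ * _).
(* In the first point the factors are reflected, and each derivative acquires a minus sign. Negating
   the first factor absorbs the sign coming from [G'], so the formula has the same form as for the
   second point. *)
have := virtual_work R Omega M sigma Omega_meas Omega_bounded stress i _ _ _ _
  (C1_lineN _ _ _ (C1_line_reflect _ _ _ p.1 CF)) (C1_line_reflect _ _ _ p.2 CG).
under eq_Rintegral do rewrite mulrNN.
by under [in RHS]eq_Rintegral do rewrite !opprK.
Qed.

End equilibrium.

Lemma integrable_mul_L2 {d} {T : measurableType d} {R : realType}
    (mu : {measure set T -> \bar R}) (a b : T -> R) :
  measurable_fun setT a -> measurable_fun setT b ->
  (sqnorm mu a < +oo)%E -> (sqnorm mu b < +oo)%E ->
  mu.-integrable setT (fun q => (a q * b q)%:E).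
Proof.
have isq (c : T -> R) : measurable_fun setT c -> (sqnorm mu c < +oo)%E ->
    mu.-integrable setT (fun q => (c q ^+ 2)%:E).
  move=> mc coo; apply/integrableP; split.
    by apply/measurable_EFinP; exact: measurable_funX.
  by under eq_integral do rewrite gee0_abs ?lee_fin ?sqr_ge0//.
move=> ma mb aoo boo.
apply: (@le_integrable _ _ _ mu setT measurableT _
  (fun q => (a q ^+ 2)%:E + (b q ^+ 2)%:E)%E).
- by apply/measurable_EFinP; exact: measurable_funM.
- move=> q _; rewrite /= lee_fin; apply: le_trans (ler_norm _).
  rewrite normrM -[a q ^+ 2]real_normK ?num_real// -[b q ^+ 2]real_normK ?num_real//.
  by have := sqr_ge0 (`|a q| - `|b q|); have := sqr_ge0 (`|a q| + `|b q|); lra.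
- by apply: integrableD; [|exact: isq|exact: isq].
Qed.

(** * Cancellation of the cofactor pairing *)

Section airy.
Context (R : realType) (Omega : set (R * R)) (M : R).
Hypotheses (Omega_meas : measurable Omega)
  (Omega_bounded : forall p, Omega p -> `|p.1| <= M /\ `|p.2| <= M).
Variables (sigma1 sigma2 : R * R -> 'M[R]_2).
Hypotheses (h1 : residual_stress Omega sigma1) (h2 : residual_stress Omega sigma2).
Local Notation a := (extension R Omega sigma1).
Local Notation b := (extension R Omega sigma2).

Let aM k l : supported R M (a k l).
Proof. by move=> q; exact: (extension_supp R Omega M sigma1 Omega_bounded). Qed.
Let bM k l : supported R M (b k l).
Proof. by move=> q; exact: (extension_supp R Omega M sigma2 Omega_bounded). Qed.
Let ia k l : (area R).-integrable setT (EFin \o a k l).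
Proof. exact: (integrable_extension R Omega M sigma1 Omega_meas Omega_bounded h1). Qed.
Let ib k l : (area R).-integrable setT (EFin \o b k l).
Proof. exact: (integrable_extension R Omega M sigma2 Omega_meas Omega_bounded h2). Qed.

Lemma integrable_extension_mul i j k l :
  (area R).-integrable setT (fun q => (a i j q * b k l q)%:E).
Proof.
apply: integrable_mul_L2.
- exact: (measurable_extension R Omega sigma1 Omega_meas h1).
- exact: (measurable_extension R Omega sigma2 Omega_meas h2).
- exact: (sqnorm_extension R Omega sigma1 h1).
- exact: (sqnorm_extension R Omega sigma2 h2).
Qed.

(* All terms reduce to the pairing of the two (0, 0) components through the
   kernel F2(x) G0(y). *)
Lemma cofactor_pairing (F0 F1 F2 G0 G1 G2 : R -> R) :
  C1_line _ F0 F1 -> C1_line _ F1 F2 -> C1_line _ G0 G1 -> C1_line _ G1 G2 ->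
  let T i j k l := pairing (plane_measure R) (b k l) (a i j) (difference_kernel F0 G2) in
  T 1 1 0 0 = T 0 1 0 1 /\ T 0 0 1 1 = T 0 1 0 1.
Proof.
move=> CF0 CF1 CG0 CG1 T.
have CN := C1_lineN _ _ _ CF1.
have right k l i F F' G G' := pairing_virtual_work_right R Omega M Omega_meas
  Omega_bounded sigma1 (b k l) h1 (bM k l) (ib k l) i F F' G G'.
have left k l i F F' G G' := pairing_virtual_work_left R Omega M Omega_meas
  Omega_bounded sigma2 (a k l) h2 (aM k l) (ia k l) i F F' G G'.
have sa := extension_sym R Omega sigma1 h1 1 0.
have sb := extension_sym R Omega sigma2 h2 1 0.
(* The mixed term moves one derivative in each point. The other two terms move both derivatives in
   the same point, and symmetry of that stress turns its [1 0] component into [0 1] between the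
   moves. *)
have T0101 : T 0 1 0 1 =
    pairing (plane_measure R) (b 0 0) (a 0 0) (difference_kernel (fun x => - - F2 x) G0).
  by rewrite /T (right 0 1 0 _ _ _ _ CF0 CG1) (left 0 0 0 _ _ _ _ CN CG0).
rewrite T0101; split.
- by rewrite /T (right 0 0 1 _ _ _ _ CF0 CG1) sa (right 0 0 0 _ _ _ _ CN CG0).
- by rewrite /T (left 0 0 1 _ _ _ _ CF0 CG1) sb (left 0 0 0 _ _ _ _ CN CG0).
Qed.

(** Each integral, times the mass of [rho], is approximated by its pairing through [rho]. The three
    pairings coincide by [cofactor_pairing], so with weights [1], [1] and [-2] only the
    approximation errors remain. *)
Lemma integral_cofactor_eq0 :
  \int[area R]_q (a 1 1 q * b 0 0 q) + \int[area R]_q (a 0 0 q * b 1 1 q) -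
  2 * \int[area R]_q (a 0 1 q * b 0 1 q) = 0.
Proof.
set I1 := \int[area R]_q (a 1 1 q * b 0 0 q).
set I2 := \int[area R]_q (a 0 0 q * b 1 1 q).
set I3 := \int[area R]_q (a 0 1 q * b 0 1 q).
apply/eqP; rewrite -normr_le0; apply/ler_addgt0Pl => e e0; rewrite addr0.
(* The weights [1], [1] and [-2] have absolute sum [4]. *)
have e4 : 0 < e / 4 by rewrite divr_gt0.
have ca i j : L2_continuous (area R) (nbhs (0 : R * R)) (@translation R) (a i j).
  apply: (L2_translation_continuous_bounded R (M + 1)).
  - exact: (measurable_extension R Omega sigma1 Omega_meas h1).
  - by move=> q /aM [q1 q2]; split; [move: q1|move: q2] => /le_lt_trans; apply; rewrite ltrDl.
  - exact: (sqnorm_extension R Omega sigma1 h1).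
have near i j k l : \forall z \near (0 : R * R),
    (\int[area R]_q (`|(a i j (translation z q) - a i j q) * b k l q|)%:E <= (e / 4)%:E)%E.
  apply: (L2_continuous_pairing (area R) (nbhs (0 : R * R)) (@translation R)
    (area_preserving_translation R) (a i j) (b k l)) => //.
  - exact: (measurable_extension R Omega sigma2 Omega_meas h2).
  - exact: (sqnorm_extension R Omega sigma2 h2).
have [d /= d0 dn] := (nbhs_ballP _ _).1
  (filterI (near 1 1 0 0) (filterI (near 0 0 1 1) (near 0 1 0 1))).
have [F0 [F1 [F2 [CF0 CF1 [F00 F0d [CF FC] [kF kF0 Fk]]]]]] := bump_with_derivatives R d d0.
have [G0 [G1 [G2 [CG0 CG1 [G20 G2d [CG GC] [kG kG0 Gk]]]]]] := bump_with_antiderivatives R d d0.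
pose rho (z : plane R) := F0 z.1 * G2 z.2.
have cF0 := C1_line_continuous _ _ _ CF0.
have cG2 : continuous G2 by case: CG1.
have mrho : measurable_fun setT rho.
  apply: measurable_funM; apply: measurableT_comp => //; exact: continuous_measurable_fun.
have rho0 z : 0 <= rho z by rewrite mulr_ge0.
have rhoC z : rho z <= CF * CG by rewrite ler_pM.
have rho_supp z : rho z != 0 -> `|z.1| < d /\ `|z.2| < d.
  by rewrite mulf_eq0 negb_or => /andP[/F0d ? /G2d ?].
pose Q := rectangle R (- d) d (- d) d.
have mQ : measurable Q by exact: measurable_rectangle.
have iQ : (area R).-integrable setT (EFin \o \1_Q).
  by apply: integrable_indic_rectangle; lra.
have irho : (area R).-integrable setT (EFin \o rho).
  apply: (@eq_integrable _ _ _ _ _ _ (fun z => (\1_Q z * rho z)%:E)) => //.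
    move=> z _; rewrite indicE; have [zQ|zQ] := boolP (z \in Q); first by rewrite mul1r.
    rewrite mul0r; congr EFin; apply/esym/eqP; apply: contraNT zQ => /rho_supp[z1 z2].
    rewrite inE /Q /rectangle; split; rewrite /= in_itv/=.
      by move: z1; rewrite ltr_norml => /andP[->] /ltW.
    by move: z2; rewrite ltr_norml => /andP[->] /ltW.
  apply: (integrable_bounded_mul _ _ _ _ _ (CF * CG)) => // z _.
  by rewrite ger0_norm.
have approx i j k l : (forall z, rho z != 0 ->
    (\int[area R]_q (`|(a i j (translation z q) - a i j q) * b k l q|)%:E <= (e / 4)%:E)%E) ->
    `|pairing (plane_measure R) (b k l) (a i j) (difference_kernel F0 G2) -
      \int[area R]_q (a i j q * b k l q) * \int[area R]_z rho z| <=
    e / 4 * \int[area R]_z rho z.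
  move=> nz.
  apply: (pairing_approximate_identity (plane_measure R) (@translation R) (@plane_sub R)
    (area_preserving_translation R) (measurable_translation R) (measurable_plane_sub R)
    _ _ (a i j) (b k l) rho (CF * CG) (e / 4)) => //.
  - by move=> z q; rewrite /translation; congr pair; rewrite addrC.
  - by move=> [z1 z2] q; congr pair; rewrite /= addrAC subrr add0r.
  - exact: integrable_extension_mul.
have dz z : rho z != 0 -> ball (0 : R * R) d z.
  by move=> /rho_supp[z1 z2]; split; rewrite /ball/= sub0r normrN.
have c0 : 0 < \int[area R]_z rho z.
  pose Q' := rectangle R (- (d / 2)) (d / 2) (- (d / 2)) (d / 2).
  have iQ' : (area R).-integrable setT (EFin \o \1_Q').
    by apply: integrable_indic_rectangle; lra.
  apply: (@lt_le_trans _ _ (\int[area R]_z (kF * kG * \1_Q' z))).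
    rewrite RintegralZl// Rintegral_indic_rectangle; [|lra..].
    by rewrite !mulr_gt0//; lra.
  apply: le_Rintegral => //.
    exact: (integrableZl measurableT (kF * kG) iQ').
  move=> z _; rewrite indicE; have [|_] := boolP (z \in Q'); last by rewrite mulr0.
  rewrite inE /Q' /rectangle => -[]; rewrite /= !in_itv/= => /andP[z1 z1'] /andP[z2 z2'].
  rewrite mulr1 ler_pM ?(ltW kF0) ?(ltW kG0)//.
    by apply: Fk; rewrite ler_norml (ltW z1).
  by apply: Gk; rewrite ler_norml (ltW z2).
set c := \int[area R]_z rho z in c0 approx *.
have A1 := approx 1 1 0 0 (fun z rz => (dn z (dz z rz)).1).
have A2 := approx 0 0 1 1 (fun z rz => (dn z (dz z rz)).2.1).
have A3 := approx 0 1 0 1 (fun z rz => (dn z (dz z rz)).2.2).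
have [/= T1 T2] := cofactor_pairing _ _ _ _ _ _ CF0 CF1 CG0 CG1.
rewrite T1 -/I1 in A1; rewrite T2 -/I2 in A2; rewrite -/I3 in A3.
(* Multiplying by the positive mass [c] brings the goal to the scale of the three approximation
   bounds, where it is linear. *)
rewrite -(ler_pM2r c0) -[X in _ * X](gtr0_norm c0) -normrM.
move: A1 A2 A3; rewrite !ler_norml => /andP[? ?] /andP[? ?] /andP[? ?].
by apply/andP; split; lra.
Qed.

End airy.

Theorem theorem3 (R : realType) (Omega : set (R * R))
  (Omega_open : open Omega)
  (Omega_bounded : exists M : R, forall p, Omega p -> `|p.1| <= M /\ `|p.2| <= M)
  (Omega_meas : measurable Omega)
  (sigma1 sigma2 : R * R -> 'M[R]_2)
  (h1 : residual_stress Omega sigma1) (h2 : residual_stress Omega sigma2) :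
  (\int[area R]_(p in Omega) (contr (sigma1 p) (sigma2 p))%:E)%E
  = (\int[area R]_(p in Omega) (\tr (sigma1 p) * \tr (sigma2 p))%:E)%E.
Proof.
have [M OM] := Omega_bounded.
pose a := extension R Omega sigma1; pose b := extension R Omega sigma2.
have iab i j k l := integrable_extension_mul R Omega Omega_meas sigma1 sigma2 h1 h2 i j k l.
have sa := extension_sym R Omega sigma1 h1 1 0.
have sb := extension_sym R Omega sigma2 h2 1 0.
(* The contraction is [u + 2 v] and the product of the traces is [u + w], so the claim reduces to
   the equality of the integrals of [w] and [2 v]. *)
pose u (q : plane R) := a 0 0 q * b 0 0 q + a 1 1 q * b 1 1 q.
pose v (q : plane R) := a 0 1 q * b 0 1 q.
pose w (q : plane R) := a 1 1 q * b 0 0 q + a 0 0 q * b 1 1 q.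
have iu : (area R).-integrable setT (EFin \o u)
  by exact: (integrableD measurableT (iab 0 0 0 0) (iab 1 1 1 1)).
have iw : (area R).-integrable setT (EFin \o w)
  by exact: (integrableD measurableT (iab 1 1 0 0) (iab 0 0 1 1)).
have iv : (area R).-integrable setT (fun q => (2 * v q)%:E)
  by exact: (integrableZl measurableT 2 (iab 0 1 0 1)).
have contrE : (\int[area R]_(p in Omega) (contr (sigma1 p) (sigma2 p))%:E =
    \int[area R]_q (u q + 2 * v q)%:E)%E.
  rewrite integral_mkcond; apply: eq_integral => q _; rewrite patchE.
  rewrite /u /v; have := sa; have := sb.
  move=> /(congr1 (fun f => f q)) + /(congr1 (fun f => f q)); rewrite /a /b /extension !patchE.
  case: ifPn => _ sbq saq; last by rewrite !(mul0r, mulr0, addr0).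
  rewrite /contr !big_ord_recl !big_ord0 (_ : lift ord0 ord0 = 1 :> 'I_2); last exact: val_inj.
  by congr EFin; rewrite -[ord0]/(0 : 'I_2) saq sbq; ring.
have trE : (\int[area R]_(p in Omega) (\tr (sigma1 p) * \tr (sigma2 p))%:E =
    \int[area R]_q (u q + w q)%:E)%E.
  rewrite integral_mkcond; apply: eq_integral => q _; rewrite patchE.
  rewrite /u /w /a /b /extension !patchE.
  case: ifPn => _; last by rewrite !mul0r !addr0.
  rewrite /mxtrace !big_ord_recl !big_ord0 (_ : lift ord0 ord0 = 1 :> 'I_2); last exact: val_inj.
  by congr EFin; rewrite -[ord0]/(0 : 'I_2); ring.
rewrite contrE trE.
have := integral_cofactor_eq0 R Omega M Omega_meas OM sigma1 sigma2 h1 h2.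
rewrite -/a -/b -RintegralD ?iab// -RintegralZl ?iab//.
move=> /subr0_eq wv.
have finE (f : plane R -> R) : (area R).-integrable setT (EFin \o f) ->
    (\int[area R]_q (f q)%:E = (\int[area R]_q f q)%:E)%E.
  by move=> if_; rewrite /Rintegral fineK//; exact: integrable_fin_num.
rewrite !finE; [|exact: (integrableD measurableT iu iw)|exact: (integrableD measurableT iu iv)].
congr EFin; rewrite [LHS]RintegralD// [RHS]RintegralD//; congr (_ + _).
exact/esym/wv.
Qed.
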